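(* Let each $X_i\subset\mathbb R$ ($i=1,\dots,d$) be a bounded interval, and let $b$ be weakly compatible, with associated partition $\{1,\dots,d\}=S_+\cup S_-$, monotone increasing in $x_i$ for each $i\in S_+$ and monotone decreasing in $x_i$ for each $i\in S_-$. If in addition $b$ is $K$-Lipschitz with respect to $\|\cdot\|_p$ on $\mathbb R^d$ ($1\le p<\infty$) and $\alpha$ is bounded by $M$, then for all $\mu_i,\nu_i\in\mathcal P(X_i)$, $i=1,\dots,d$, $$\left|\max_{\gamma\in\Gamma(\mu_1,\dots,\mu_d)}\mathcal R_\alpha(b_\#\gamma)-\max_{\gamma\in\Gamma(\nu_1,\dots,\nu_d)}\mathcal R_\alpha(b_\#\gamma)\right|\le MK\left(\sum_{i=1}^d W_p(\mu_i,\nu_i)^p\right)^{1/p}.$$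
   Context: $\Gamma(\mu_1,\dots,\mu_d)$ is the set of Borel probability measures on $X_1\times\cdots\times X_d$ with marginals $\mu_i$; $T_\#$ is push-forward. The spectral function $\alpha:[0,1]\to[0,\infty)$ is nondecreasing. For $\mu\in\mathcal P(\mathbb R)$, $F_\mu^{-1}(m)=\inf\{x:\mu((-\infty,x])\ge m\}$ and $\mathcal R_\alpha(\mu)=\int_0^1F_\mu^{-1}(m)\alpha(m)\,dm$. $W_p$ is the $p$-Wasserstein distance on $\mathcal P(\mathbb R)$, and $\|x\|_p=(\sum_i|x_i|^p)^{1/p}$. $b\in C^2(X_1\times\cdots\times X_d)$ is weakly compatible if for each $i\ne j$ either $\frac{\partial^2b}{\partial x_i\partial x_j}\ge0$ throughout the domain or $\le0$ throughout the domain, and $\frac{\partial^2b}{\partial x_i\partial x_j}\frac{\partial^2b}{\partial x_k\partial x_j}\frac{\partial^2b}{\partial x_k\partial x_i}\ge0$ everywhere for all distinct $i,j,k$. The associated partition $\{1,\dots,d\}=S_+\cup S_-$ into disjoint sets is such that, for $i\neq j$, $\frac{\partial^2b}{\partial x_i\partial x_j}\ge0$ throughout if $i,j$ are both in $S_+$ or both in $S_-$, and $\le0$ throughout otherwise. *)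

(* Defs.v *)
Set Warnings "-notation-overridden,-notation-incompatible-prefix,-ambiguous-paths".
From HB Require Import structures.
From mathcomp Require Import all_boot all_order all_algebra.
From mathcomp Require Import all_classical all_reals all_analysis.
Set Implicit Arguments.
Unset Strict Implicit.
Unset Printing Implicit Defensive.
Import Order.TTheory GRing.Theory Num.Theory.
Import numFieldNormedType.Exports.
Local Open Scope classical_set_scope.
Local Open Scope ring_scope.

(* Points of R^d are row vectors. A function on a subset X
   of R^d is a function on R^d of which only the values on X are used, and an
   element of P(X_i) is a Borel probability measure on R giving mass 1 to X_i. *)

Definition borel_rV (R : realType) (d : nat) :=
  g_sigma_algebraType (@open 'rV[R]_d).

Section calculus.
Context {R : realType} {d : nat}.
Implicit Types (X : set 'rV[R]_d) (f b : 'rV[R]_d -> R).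

Definition box (I : 'I_d -> set R) : set 'rV[R]_d :=
  [set x | forall i, I i (x ord0 i)].

(* Increments h -> 0, h <> 0, for which x + h e_i stays in X: derivatives are
   one-sided at the endpoints of the intervals. *)
Definition increments X (i : 'I_d) (x : 'rV[R]_d) : set_system R :=
  within [set h | X (x + h *: delta_mx ord0 i)] 0^'.

Definition diff_quotient f (i : 'I_d) (x : 'rV[R]_d) (h : R) : R :=
  h^-1 * (f (x + h *: delta_mx ord0 i) - f x).

Definition pderivable X (i : 'I_d) f x :=
  cvg (diff_quotient f i x @ increments X i x).

(* The filter of increments is degenerate exactly when there is no nonzero
   admissible increment near 0, which for a box means that the i-th interval is
   a single point; such a variable is constant and its partial derivatives are
   taken to be 0. *)
Definition pderiv X (i : 'I_d) f x : R :=
  if `[< increments X i x set0 >] then 0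
  else lim (diff_quotient f i x @ increments X i x).

(* d^2 f / (dx_i dx_j) *)
Definition pderiv2 X (i j : 'I_d) f : 'rV[R]_d -> R :=
  pderiv X i (pderiv X j f).

Definition C1_on X f :=
  {within X, continuous f} /\
  forall i, (forall x, X x -> pderivable X i f x) /\
            {within X, continuous (pderiv X i f)}.

Definition C2_on X f := C1_on X f /\ forall i, C1_on X (pderiv X i f).

Definition weakly_compatible X b :=
  [/\ C2_on X b,
      forall i j, i != j ->
        (forall x, X x -> 0 <= pderiv2 X i j b x) \/
        (forall x, X x -> pderiv2 X i j b x <= 0) &
      forall i j k, i != j -> j != k -> i != k -> forall x, X x ->
        0 <= pderiv2 X i j b x * pderiv2 X k j b x * pderiv2 X k i b x].

Definition associated_partition X b (Sp Sm : {set 'I_d}) :=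
  [/\ (Sp :|: Sm)%SET = [set: 'I_d]%SET,
      (Sp :&: Sm)%SET = finset.set0 &
      forall i j, i != j -> forall x, X x ->
        if ((i \in Sp) && (j \in Sp)) || ((i \in Sm) && (j \in Sm))
        then 0 <= pderiv2 X i j b x else pderiv2 X i j b x <= 0].

Definition increasing_in X (i : 'I_d) f :=
  forall x y, X x -> X y -> (forall j, j != i -> x ord0 j = y ord0 j) ->
    x ord0 i <= y ord0 i -> f x <= f y.

Definition decreasing_in X (i : 'I_d) f :=
  forall x y, X x -> X y -> (forall j, j != i -> x ord0 j = y ord0 j) ->
    x ord0 i <= y ord0 i -> f y <= f x.

Definition pnorm (p : R) (x : 'rV[R]_d) : R :=
  (\sum_(i < d) `|x ord0 i| `^ p) `^ p^-1.

Definition pnorm_lipschitz_on X (p K : R) f :=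
  forall x y, X x -> X y -> `|f x - f y| <= K * pnorm p (x - y).

End calculus.

Section transport.
Context {R : realType}.
Implicit Types (mu nu : probability (measurableTypeR R) R) (m p : R).

Definition couplings d (mu : 'I_d -> probability (measurableTypeR R) R) :
    set (probability (borel_rV R d) R) :=
  [set gamma | forall i (A : set (measurableTypeR R)), measurable A ->
     pushforward gamma
       ((fun x => x ord0 i) : borel_rV R d -> measurableTypeR R) A = mu i A].

Definition couplings2 mu nu :
    set (probability (measurableTypeR R * measurableTypeR R)%type R) :=
  [set pi | forall A : set (measurableTypeR R), measurable A ->
     pushforward pi fst A = mu A /\ pushforward pi snd A = nu A].

Definition Wasserstein p mu nu : \bar R :=
  (ereal_inf [set \int[pi]_z (`|(z.1 : R) - (z.2 : R)| `^ p)%:E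
             | pi in couplings2 mu nu] `^ p^-1)%E.

Definition quantile (mu : set (measurableTypeR R) -> \bar R) m : \bar R :=
  ereal_inf [set x%:E | x in [set x : R | (m%:E <= mu [set` `]-oo, x]])%E]].

(* The quantile at 0 is -oo; it only matters on a Lebesgue-null set. *)
Definition spectral_risk (alpha : R -> R)
    (mu : set (measurableTypeR R) -> \bar R) : \bar R :=
  (\int[lebesgue_measure]_(m in `[0%R, 1%R]) (quantile mu m * (alpha m)%:E))%E.

(* b is extended by 0 outside X, which is a null set for the measures gamma
   considered, so this is the image of gamma under b restricted to X. *)
Definition image_law d (X : set 'rV[R]_d) (b : 'rV[R]_d -> R)
    (gamma : probability (borel_rV R d) R) : set (measurableTypeR R) -> \bar R :=
  pushforward gamma (b \_ X : borel_rV R d -> measurableTypeR R).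

Definition is_max (A : set (\bar R)) (v : \bar R) := A v /\ ubound A v.

End transport.

(* Main.v *)
(* After changing the sign of the variables in S_-, b is increasing and has
   increasing differences (by the mean value theorem applied twice). Let W(m) be
   the vector of the m-quantiles of the marginals and h = b o W, which is
   nondecreasing on ]0, 1[. For a chain y^0 <= ... <= y^n of points W(t_k), going
   up the chain one coordinate at a time gives
   (b(x) - b(y^0))^+ <= sum_k sum_i 1[x_i > y^k_i] delta_(k,i) + error with
   sum_i delta_(k,i) = b(y^(k+1)) - b(y^k). The right-hand side only involves the
   marginals, so for every coupling E (b(x) - h(t))^+ <= int (h - h(t))^+ when the
   chain gets finer. Hence int_t^1 of the quantile of the law of b(x) is at most
   int_t^1 h, and approximating alpha by step functions the risk is at most
   int h alpha, with equality for the comonotone coupling W(U). The same bound for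
   two marginals and the function L (x + y) - |x - y|^p shows that the comonotone
   coupling is also optimal for W_p. The two maxima int h alpha are then compared
   pointwise with the Lipschitz condition, followed by Jensen's inequality. *)
Require Import Defs.
From HB Require Import structures.
Set Warnings "-notation-overridden,-notation-incompatible-prefix,-ambiguous-paths".
From mathcomp Require Import all_boot all_order all_algebra.
From mathcomp Require Import all_classical all_reals all_analysis.
From mathcomp Require Import measurable_realfun ring lra.
Set Implicit Arguments.
Unset Strict Implicit.
Unset Printing Implicit Defensive.
Import Order.TTheory GRing.Theory Num.Theory.
Import numFieldNormedType.Exports.
Local Open Scope classical_set_scope.
Local Open Scope ring_scope.

(** * Increasing differences along chains *)

(** The positive part (b - c)^+ of an increasing function with increasing differences has both
    properties again; this is where the monotonicity of b enters in addition to the signs of its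
    mixed derivatives. The chain inequality is a discretised Kantorovich dual for that cost: its
    right-hand side is a sum of functions of single coordinates, so its expectation is controlled by
    the tails P(x_i > W_i(t)) <= 1 - t, for all couplings at once. The levels are h(t) because, h
    being nondecreasing, int_t^1 h = (1 - t) h(t) + int (h - h(t))^+, whereas an arbitrary q only
    satisfies int_t^1 q <= (1 - t) h(t) + int (q - h(t))^+. One comonotone vector thus serves every
    nondecreasing alpha, and the maximum is exhibited rather than found by compactness. Bounded
    intervals and the Lipschitz condition make all the random variables bounded, so the argument
    runs with real-valued expectations. *)

Section coordinates.
Context {R : realType} {d : nat}.
Implicit Types (u v w x y : 'I_d -> R) (i j : 'I_d).

Definition update u i (a : R) : 'I_d -> R := fun j => if j == i then a else u j.

Definition mix k u v : 'I_d -> R := fun j => if (j < k)%N then v j else u j.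

Definition in_box (J : 'I_d -> set R) u := forall i, J i (u i).

Lemma mix0 u v : mix 0 u v = u.
Proof. by []. Qed.

Lemma mix_full u v : mix d u v = v.
Proof. by apply/funext => j; rewrite /mix ltn_ord. Qed.

Lemma mixS i u v : mix i.+1 u v = update (mix i u v) i (v i).
Proof.
apply/funext => j; rewrite /mix /update ltnS leq_eqVlt.
by case: (eqVneq j i) => [->|ne]; rewrite ?eqxx //= (negbTE (ne : (val j != val i)%N)).
Qed.

Lemma update_mix i u v : update (mix i u v) i (u i) = mix i u v.
Proof.
apply/funext => j; rewrite /mix /update.
by case: (eqVneq j i) => [->|//]; rewrite ltnn.
Qed.

Lemma in_box_update J u i a : in_box J u -> J i a -> in_box J (update u i a).
Proof. by move=> Ju Ja j; rewrite /update; case: eqP => [->|]. Qed.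

Lemma in_box_mix J k u v : in_box J u -> in_box J v -> in_box J (mix k u v).
Proof. by move=> Ju Jv j; rewrite /mix; case: ifP. Qed.

Lemma telescope_mix (g : ('I_d -> R) -> R) u v :
  \sum_(i < d) (g (mix i.+1 u v) - g (mix i u v)) = g v - g u.
Proof.
rewrite -(big_mkord xpredT (fun k : nat => g (mix k.+1 u v) - g (mix k u v))).
rewrite (telescope_sumr (fun k : nat => g (mix k u v)))// mix_full mix0//.
Qed.

Lemma coordinatewise_mono (J : 'I_d -> set R) (g : ('I_d -> R) -> R) :
  (forall u i a, in_box J u -> J i a -> u i <= a -> g u <= g (update u i a)) ->
  forall u v, in_box J u -> in_box J v -> (forall i, u i <= v i) -> g u <= g v.
Proof.
move=> gi u v Ju Jv uv; rewrite -subr_ge0 -telescope_mix sumr_ge0// => i _.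
rewrite subr_ge0 mixS gi //; first exact: in_box_mix.
by rewrite /mix ltnn.
Qed.

Definition box_mono (J : 'I_d -> set R) (f : ('I_d -> R) -> R) :=
  forall u v, in_box J u -> in_box J v -> (forall i, u i <= v i) -> f u <= f v.

(** Supermodularity on the box, phrased through one-coordinate increments: the form in which a step
    of a chain is compared with a step from a lower point. *)
Definition increasing_differences (J : 'I_d -> set R) (f : ('I_d -> R) -> R) :=
  forall i u v a a', in_box J u -> in_box J v -> J i a -> J i a' -> a <= a' ->
  (forall j, u j <= v j) ->
  f (update u i a') - f (update u i a) <= f (update v i a') - f (update v i a).

Lemma update_update u i a a' : update (update u i a) i a' = update u i a'.
Proof. by apply/funext => j; rewrite /update; case: eqP. Qed.

Lemma update_comm u i j a c : i != j -> update (update u i a) j c = update (update u j c) i a.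
Proof.
move=> ij; apply/funext => k; rewrite /update; case: (eqVneq k j) => // ->.
by rewrite eq_sym (negbTE ij).
Qed.

(** An increment in coordinate [i] is a function of the other coordinates that may be raised one at
    a time, so pairs of coordinates suffice. This is the form that mixed second derivatives
    deliver. *)
Lemma pairwise_increasing_differences (J : 'I_d -> set R) (f : ('I_d -> R) -> R) :
  (forall i j u a a' c c', i != j -> in_box J u ->
     J i a -> J i a' -> a <= a' -> J j c -> J j c' -> c <= c' ->
     0 <= f (update (update u j c') i a') - f (update (update u j c') i a)
          - (f (update (update u j c) i a') - f (update (update u j c) i a))) ->
  increasing_differences J f.
Proof.
move=> pw i u v a a' Ju Jv Ja Ja' aa' uv.
apply: (@coordinatewise_mono J (fun w => f (update w i a') - f (update w i a))) => //.
move=> w j c Jw Jc wc; have [->|ij] := eqVneq i j; first by rewrite !update_update.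
have {1 2}-> : w = update w j (w j).
  by apply/funext => k; rewrite /update; case: eqP => [->|].
by rewrite -subr_ge0; exact: pw.
Qed.

(** The delta_(k,i) of the overview, for the step from [y] to [y']. *)
Definition step_gain (f : ('I_d -> R) -> R) y y' i :=
  f (mix i.+1 y y') - f (mix i y y').

Lemma step_gain_sum f y y' : \sum_(i < d) step_gain f y y' i = f y' - f y.
Proof. exact: telescope_mix. Qed.

Section greedy.
Variables (J : 'I_d -> set R) (f : ('I_d -> R) -> R).
Hypotheses (fmono : box_mono J f) (fid : increasing_differences J f).

Lemma step_gain_ge0 y y' i : in_box J y -> in_box J y' -> (forall j, y j <= y' j) ->
  0 <= step_gain f y y' i.
Proof.
move=> Jy Jy' yy'; rewrite subr_ge0 mixS; apply: fmono.
- exact: in_box_mix.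
- by apply: in_box_update => //; exact: in_box_mix.
- move=> j; rewrite /update; case: eqP => [->|//]; by rewrite /mix ltnn.
Qed.

(** One step of the chain against a move from [u] to [u'] below it. Coordinates outside [A] stand
    still and those in [A] start on the chain, so by monotonicity the latter may be raised all the
    way to [y'], giving [v]. Each of them is then raised from a point below the corresponding point
    of the chain, and increasing differences apply. *)
Let block (A : 'I_d -> bool) y y' u u' :
  in_box J y -> in_box J y' -> in_box J u -> in_box J u' ->
  (forall j, y j <= y' j) -> (forall j, u j <= y j) -> (forall j, u' j <= y' j) ->
  (forall j, A j -> u j = y j) -> (forall j, ~~ A j -> u' j = u j) ->
  f u' - f u <= \sum_(i < d) (A i)%:R * step_gain f y y' i.
Proof.
move=> Jy Jy' Ju Ju' yy' uy u'y' uA u'A.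
pose v j := if A j then y' j else u j.
have Jv : in_box J v by move=> j; rewrite /v; case: ifP.
apply: (@le_trans _ _ (f v - f u)).
  rewrite lerD2r; apply: fmono => // j; rewrite /v.
  by case: ifPn => // Aj; rewrite u'A.
rewrite -telescope_mix; apply: ler_sum => k _.
have [Ak|Ak] := boolP (A k); last first.
  have vk : v k = u k by rewrite /v (negbTE Ak).
  by rewrite mixS vk update_mix subrr mul0r.
have vk : v k = y' k by rewrite /v Ak.
rewrite mul1r /step_gain !mixS vk -{2}(update_mix k u v) -{2}(update_mix k y y') uA//.
apply: fid => //; [exact: in_box_mix..|].
move=> j; rewrite /mix /v; case: ifP => _; last exact: uy.
by case: ifPn => // _; rewrite (le_trans (uy j)).
Qed.

(* The greedy dual of the transport problem along the chain [y]: going up the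
   chain one coordinate at a time, a step of coordinate [i] from level [k] is
   charged to [x i] only, and increasing differences make the charge at least
   the increment of [f] at the truncation of [x] to the chain. *)
Lemma stop_loss_dual (n : nat) (y : nat -> 'I_d -> R) (B : R) x :
  (forall k, in_box J (y k)) -> in_box J x ->
  (forall k i, y k i <= y k.+1 i) ->
  f x - f (y 0) <= B -> 0 <= B ->
  Num.max (f x - f (y 0)) 0 <=
  \sum_(k < n) \sum_(i < d) (y k i < x i)%R%:R * step_gain f (y k) (y k.+1) i
  + \sum_(i < d) (y n i < x i)%R%:R * B.
Proof.
move=> Jy Jx yS fB B0.
have S10 : 0 <= \sum_(k < n) \sum_(i < d) (y k i < x i)%R%:R * step_gain f (y k) (y k.+1) i.
  apply: sumr_ge0 => k _; apply: sumr_ge0 => i _.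
  by rewrite mulr_ge0// step_gain_ge0.
(* Above the top of the chain a single term [B] already dominates the left-hand side. *)
have [[i0 xi0]|nx] := pselect (exists i, y n i < x i).
  rewrite ge_max; apply/andP; split; last first.
    by rewrite addr_ge0//; apply: sumr_ge0 => i _; rewrite mulr_ge0.
  apply: (le_trans fB); rewrite -[leLHS]add0r lerD// (bigD1 i0)//= xi0 mul1r.
  by rewrite lerDl sumr_ge0// => i _; rewrite mulr_ge0.
have xy i : x i <= y n i.
  by rewrite leNgt; apply/negP => h; apply: nx; exists i.
have ynd k l i : (k <= l)%N -> y k i <= y l i.
  move=> kl; rewrite -(subnK kl); elim: (l - k)%N => [//|m ih].
  by rewrite (le_trans ih)// addSn.
rewrite ler_wpDr//; first by apply: sumr_ge0 => i _; rewrite mulr_ge0.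
(* [x] raised to [y 0] and cut off at [y k]. From [w k] to [w k.+1] only coordinates with
   [y k i < x i] move, and they start exactly at [y k i], as [block] requires. *)
pose w k i := Num.min (Num.max (x i) (y 0%N i)) (y k i).
have Jw k : in_box J (w k).
  move=> i; rewrite /w; case: (leP (Num.max (x i) (y 0%N i)) (y k i)) => _; last exact: Jy.
  by case: (leP (x i) (y 0%N i)) => _; [exact: Jy|exact: Jx].
have w0 : w 0%N = y 0%N.
  by apply/funext => i; rewrite /w min_r// le_max lexx orbT.
have wn : w n = fun i => Num.max (x i) (y 0%N i).
  by apply/funext => i; rewrite /w min_l// ge_max xy ynd.
apply: (@le_trans _ _ (f (w n) - f (w 0%N))).
  rewrite ge_max w0 subr_ge0 lerD2r; apply/andP; split; apply: fmono => //.
  - by move=> i; rewrite wn le_max lexx.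
  - by move=> i; rewrite wn le_max lexx orbT.
rewrite -(telescope_sumr (fun k => f (w k)))// big_mkord; apply: ler_sum => k _.
apply: (@block (fun i => y k i < x i)) => //.
- by move=> j; rewrite /w ge_min lexx orbT.
- by move=> j; rewrite /w ge_min lexx orbT.
- by move=> j yx; rewrite /w min_r// le_max (ltW yx).
- move=> j; rewrite -leNgt => xyk; rewrite /w !min_l// ge_max ?ynd ?andbT//.
  by rewrite (le_trans xyk).
Qed.

End greedy.
End coordinates.

(** * Expectations of bounded random variables *)

Section bounded_measurable.
Context {R : realType} {d0 : measure_display} {T : measurableType d0}.
Implicit Types (f g : T -> R).

(** Boundedness everywhere, not just almost everywhere, makes this class stable under all the
    operations used and integrable for every probability. *)
Definition bm f := measurable_fun [set: T] f /\ exists B, forall x, `|f x| <= B.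

Lemma bm_cst (c : R) : bm (fun=> c).
Proof. by split; [exact: measurable_cst | exists `|c|]. Qed.

Lemma bmD f g : bm f -> bm g -> bm (fun x => f x + g x).
Proof.
move=> [mf [B fB]] [mg [C gC]]; split; first exact: measurable_funD.
by exists (B + C) => x; rewrite (le_trans (ler_normD _ _))// lerD.
Qed.

Lemma bmM f g : bm f -> bm g -> bm (fun x => f x * g x).
Proof.
move=> [mf [B fB]] [mg [C gC]]; split; first exact: measurable_funM.
by exists (B * C) => x; rewrite normrM ler_pM.
Qed.

Lemma bmZ (c : R) f : bm f -> bm (fun x => c * f x).
Proof. exact/bmM/bm_cst. Qed.

Lemma bmB f g : bm f -> bm g -> bm (fun x => f x - g x).
Proof.
move=> mf mg; have := bmD mf (bmZ (- 1) mg).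
by under eq_fun do rewrite mulN1r.
Qed.

Lemma bm_max f g : bm f -> bm g -> bm (fun x => Num.max (f x) (g x)).
Proof.
move=> [mf [B fB]] [mg [C gC]]; split; first exact: measurable_maxr.
exists (Num.max B C) => x; rewrite le_max.
by case: (leP (f x) (g x)) => _; rewrite ?fB ?gC ?orbT.
Qed.

Lemma bm_sum (I : Type) (s : seq I) (F : I -> T -> R) :
  (forall i, bm (F i)) -> bm (fun x => \sum_(i <- s) F i x).
Proof.
move=> mF; elim: s => [|i s ih].
  by under eq_fun do rewrite big_nil; exact: bm_cst.
by under eq_fun do rewrite big_cons; exact: bmD.
Qed.

Lemma bm_indic (A : set T) : measurable A -> bm (\1_A).
Proof.
move=> mA; split; first exact: measurable_indic.
by exists 1 => x; rewrite indicE; case: (_ \in _); rewrite ?normr1 ?normr0.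
Qed.


Lemma ltr_indicE (a : R) f :
  (fun x => (a < f x)%R%:R) = \1_(f @^-1` `]a, +oo[) :> (T -> R).
Proof.
apply/funext => x; rewrite indicE; congr (_%:R); congr nat_of_bool.
apply/idP/idP; first by move=> h; rewrite inE /= in_itv/= andbT.
by rewrite inE /= in_itv/= andbT.
Qed.

Lemma bm_lt (a : R) f : measurable_fun setT f -> bm (fun x => (a < f x)%R%:R).
Proof.
move=> mf; rewrite ltr_indicE; apply: bm_indic.
by rewrite -[X in measurable X]setTI; exact: mf.
Qed.

End bounded_measurable.

Section expectation.
Context {R : realType} {d0 : measure_display} {T : measurableType d0}.
Variable P : probability T R.
Implicit Types (f g : T -> R).

Definition E f : R := \int[P]_x f x.

Lemma bm_integrable f (A : set T) : measurable A -> bm f ->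
  P.-integrable A (EFin \o f).
Proof.
move=> mA [mf [B fB]]; apply: (integrableS measurableT) => //.
apply: measurable_bounded_integrable => //.
  by rewrite -ge0_fin_numE ?fin_num_measure//.
by exists B; split; [exact: num_real | move=> M BM x _ /=; rewrite (le_trans (fB x))// ltW].
Qed.

Lemma E_cst c : E (fun=> c) = c.
Proof. by rewrite /E Rintegral_cst// [X in fine X](probability_setT P) mulr1. Qed.

Lemma ED f g : bm f -> bm g -> E (fun x => f x + g x) = E f + E g.
Proof. by move=> bf bg; rewrite /E RintegralD//; exact: bm_integrable. Qed.

Lemma EB f g : bm f -> bm g -> E (fun x => f x - g x) = E f - E g.
Proof. by move=> bf bg; rewrite /E RintegralB//; exact: bm_integrable. Qed.

Lemma EZ c f : bm f -> E (fun x => c * f x) = c * E f.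
Proof. by move=> bf; rewrite /E RintegralZl//; exact: bm_integrable. Qed.

Lemma E_sum (I : Type) (s : seq I) (F : I -> T -> R) :
  (forall i, bm (F i)) -> E (fun x => \sum_(i <- s) F i x) = \sum_(i <- s) E (F i).
Proof.
move=> mF; elim: s => [|i s ih].
  by under [X in E X]eq_fun do rewrite big_nil; rewrite big_nil E_cst.
under [X in E X]eq_fun do rewrite big_cons.
by rewrite big_cons ED ?ih//; exact: bm_sum.
Qed.

Lemma E_ge0 f : (forall x, 0 <= f x) -> 0 <= E f.
Proof. by move=> f0; apply: Rintegral_ge0. Qed.

Lemma E_indic (A : set T) : measurable A -> (E \1_A)%:E = P A.
Proof.
move=> mA; rewrite /E /Rintegral integral_indic// setIT fineK//.
exact: fin_num_measure.
Qed.

Lemma E_restrict (D : set T) f : measurable D -> P D = 1%E -> bm f ->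
  E f = \int[P]_(x in D) f x.
Proof.
move=> mD PD bf; rewrite /E /Rintegral.
rewrite (@negligible_integral _ _ _ P setT (~` D))//.
- by rewrite setDE setCK setTI.
- exact: measurableC.
- exact: bm_integrable.
- by rewrite [LHS](probability_setC P)// PD subee.
Qed.

Lemma E_le (D : set T) f g : measurable D -> P D = 1%E -> bm f -> bm g ->
  (forall x, D x -> f x <= g x) -> E f <= E g.
Proof.
move=> mD PD bf bg fg; rewrite !(@E_restrict D)//.
by apply: le_Rintegral => //; exact: bm_integrable.
Qed.

Lemma E_leT f g : bm f -> bm g -> (forall x, f x <= g x) -> E f <= E g.
Proof. by move=> bf bg fg; apply: (@E_le setT) => //; exact: probability_setT. Qed.

Lemma E_eq (D : set T) f g : measurable D -> P D = 1%E -> bm f -> bm g ->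
  (forall x, D x -> f x = g x) -> E f = E g.
Proof.
by move=> mD PD bf bg fg; apply/le_anti/andP; split; apply: (@E_le D) => // x Dx;
  rewrite fg.
Qed.

Lemma prob_eq (D A B : set T) : measurable D -> P D = 1%E ->
  measurable A -> measurable B -> (forall x, D x -> A x <-> B x) -> P A = P B.
Proof.
move=> mD PD mA mB AB; rewrite -!E_indic//; congr EFin.
apply: (E_eq mD PD) => [||x Dx]; [exact: bm_indic..|].
by rewrite !indicE; congr (_%:R); congr nat_of_bool; apply/idP/idP;
  rewrite !inE => /(AB _ Dx).
Qed.

(** The union bound, obtained by integrating 1_D >= 1 - sum_i 1_(~ A_i), where D is the
    intersection. *)
Lemma prob_forall (I : finType) (A : I -> set T) :
  (forall i, measurable (A i)) -> (forall i, P (A i) = 1%E) ->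
  measurable [set w | forall i, A i w] /\ P [set w | forall i, A i w] = 1%E.
Proof.
move=> mA PA.
have -> : [set w | forall i, A i w] = \bigcap_(i in [set: I]) A i.
  by apply/seteqP; split => w /= h i //; exact: h.
have mD : measurable (\bigcap_(i in [set: I]) A i).
  by apply: fin_bigcap_measurable => //; exact: finite_finset.
split=> //; apply/eqP; rewrite eq_le probability_le1//= -(E_indic mD) lee_fin.
have bC i : bm (\1_(~` A i) : T -> R) by apply/bm_indic/measurableC.
apply: (@le_trans _ _ (E (fun w => 1 - \sum_(i : I) \1_(~` A i) w))).
  rewrite EB ?E_cst ?E_sum//; [|exact: bm_cst|exact: bm_sum].
  rewrite big1 ?subr0// => i _; apply: EFin_inj; rewrite E_indic; last exact: measurableC.
  by rewrite [LHS](probability_setC P)// PA subee.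
apply: E_leT; [|exact: bm_indic|move=> w].
  by apply: bmB; [exact: bm_cst|exact: bm_sum].
have [wD|wD] := pselect ((\bigcap_(i in [set: I]) A i) w).
  by rewrite indicE mem_set// lerBlDr lerDl sumr_ge0.
have [i /not_implyP[_ nA]] : exists i, ~ ([set: I] i -> A i w) by exact/existsNP.
rewrite indicE memNset// subr_le0 (bigD1 i)//= indicE mem_set// lerDl.
exact: sumr_ge0.
Qed.

End expectation.

Lemma bm_comp {R : realType} d1 d2 (T1 : measurableType d1) (T2 : measurableType d2)
  (Z : T1 -> T2) (phi : T2 -> R) : measurable_fun setT Z -> bm phi -> bm (phi \o Z).
Proof.
move=> mZ [mphi [B pB]]; split; first exact: measurableT_comp.
by exists B => x; exact: pB.
Qed.

Lemma E_same_law {R : realType} d1 d2 d3 (T1 : measurableType d1)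
  (T2 : measurableType d2) (T3 : measurableType d3) (P1 : probability T1 R)
  (P2 : probability T2 R) (Z1 : T1 -> T3) (Z2 : T2 -> T3) (phi : T3 -> R) :
  measurable_fun setT Z1 -> measurable_fun setT Z2 -> bm phi ->
  (forall A, measurable A -> P1 (Z1 @^-1` A) = P2 (Z2 @^-1` A)) ->
  E P1 (phi \o Z1) = E P2 (phi \o Z2).
Proof.
move=> mZ1 mZ2 bphi same; have mphi : measurable_fun setT (EFin \o phi).
  by apply/measurable_EFinP; exact: bphi.1.
rewrite /E /Rintegral; congr fine.
have i1 : P1.-integrable (Z1 @^-1` setT) ((EFin \o phi) \o Z1).
  apply: (@bm_integrable _ _ _ P1 (phi \o Z1)); last exact: bm_comp.
  by rewrite preimage_setT.
have i2 : P2.-integrable (Z2 @^-1` setT) ((EFin \o phi) \o Z2).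
  apply: (@bm_integrable _ _ _ P2 (phi \o Z2)); last exact: bm_comp.
  by rewrite preimage_setT.
apply: etrans (esym (integral_pushforward mZ1 mphi i1 measurableT)) _.
apply: etrans _ (integral_pushforward mZ2 mphi i2 measurableT).
by apply: eq_measure_integral => A mA _; exact: same.
Qed.

Section law.
Context {R : realType} d1 d2 (T1 : measurableType d1) (T2 : measurableType d2).

Definition law (P : probability T1 R) (Z : T1 -> T2) (mZ : measurable_fun setT Z) :
    probability T2 R :=
  distribution P (HB.pack_for {mfun T1 >-> T2} Z (isMeasurableFun.Build _ _ _ _ Z mZ)).

Lemma lawE P Z (mZ : measurable_fun setT Z) A : law P mZ A = P (Z @^-1` A).
Proof. by []. Qed.

End law.

(** * Quantile functions *)

Section uniform.
Context {R : realType}.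

Definition unif : probability (measurableTypeR R) R := uniform_prob (@ltr01 R).

Lemma unifE (A : set R) : measurable A ->
  unif A = (lebesgue_measure (A `&` `[0%R, 1%R])).
Proof.
move=> mA; rewrite -[A in LHS]setIT -integral_indic//.
rewrite integral_uniform//; last by apply/measurable_EFinP; exact: measurable_indic.
by rewrite subr0 invr1 mul1e integral_indic.
Qed.

Lemma unif_open : unif `]0%R, 1%R[%classic = 1%E.
Proof.
rewrite unifE// setIidl; last exact: subset_itv_oo_cc.
by rewrite lebesgue_measure_itv/= lte_fin ltr01 -EFinB subr0.
Qed.

Lemma unif_gt (t : R) : 0 <= t <= 1 -> unif `]t, +oo[%classic = (1 - t)%:E.
Proof.
move=> /andP[t0 t1]; rewrite unifE//.
have -> : (`]t, +oo[ `&` `[0, 1] : set R) = `]t, 1]%classic.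
  apply/seteqP; split => x /=; rewrite !in_itv/= ?andbT.
    by move=> [-> /andP[_ ->]].
  by move=> /andP[tx ->]; rewrite tx (le_trans t0 (ltW tx)).
by rewrite lebesgue_measure_itv/= lte_fin; case: ltgtP t1 => // -> _; rewrite subrr.
Qed.

Lemma unif_ge (t : R) : 0 <= t <= 1 -> unif `[t, +oo[%classic = (1 - t)%:E.
Proof.
move=> /andP[t0 t1]; rewrite unifE//.
have -> : (`[t, +oo[ `&` `[0, 1] : set R) = `[t, 1]%classic.
  apply/seteqP; split => x /=; rewrite !in_itv/= ?andbT.
    by move=> [-> /andP[_ ->]].
  by move=> /andP[tx ->]; rewrite tx (le_trans t0 tx).
by rewrite lebesgue_measure_itv/= lte_fin; case: ltgtP t1 => // -> _; rewrite subrr.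
Qed.

End uniform.

Lemma measure_eq_rays {R : realType} (m1 m2 : probability (measurableTypeR R) R) :
  (forall x, m1 `]x, +oo[%classic = m2 `]x, +oo[%classic) ->
  forall A, measurable A -> m1 A = m2 A.
Proof.
move=> m12 A mA.
have GE : measurable = <<s @RGenOInfty.G R >> := @RGenOInfty.measurableE R.
apply: (@measure_unique _ R (measurableTypeR R) _ (fun n => `](- n%:R)%R, +oo[%classic)
  GE _ _ _ m1 m2) => //.
- move=> _ _ [x ->] [y ->]; exists (Num.max x y).
  apply/seteqP; split => z /=; rewrite !in_itv/= !andbT gt_max.
    by move=> [-> ->].
  by move=> /andP[].
- by move=> n; eexists; reflexivity.
- apply/seteqP; split => // x _; exists (Num.truncn `|x|).+1 => //=.
  rewrite in_itv/= andbT ltrNl; apply: le_lt_trans (truncnS_gt _).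
  by rewrite -normrN ler_norm.
- by move=> _ [x ->]; exact: m12.
- by move=> k; rewrite -ge0_fin_numE ?fin_num_measure//.
Qed.

Section real_quantile.
Context {R : realType}.
Variable rho : probability (measurableTypeR R) R.

Definition quantile_set (m : R) : set R := [set x | (m%:E <= rho `]-oo, x]%classic)%E].

(* The value outside [`]0, 1[] is junk: that set is null for [unif]. *)
Definition real_quantile (m : R) : R := if m \in `]0, 1[ then inf (quantile_set m) else 0.

Variable B : R.
Hypothesis rhoB : rho `[- B, B]%classic = 1%E.

Let qsetB m : m <= 1 -> quantile_set m B.
Proof.
move=> m1; rewrite /quantile_set/= (@le_trans _ _ 1%E) ?lee_fin//.
by rewrite -rhoB le_measure ?inE//; apply: subset_itvr.
Qed.

Let qset_lb m : 0 < m -> lbound (quantile_set m) (- B).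
Proof.
move=> m0 x mx; rewrite leNgt; apply/negP => xB; move: mx; apply/negP.
rewrite -ltNge (@le_lt_trans _ _ 0%E)// -(subee (x := 1%E))// -{2}rhoB -probability_setC//.
rewrite le_measure ?inE//; first exact: measurableC.
move=> z /=; rewrite !in_itv/= => zx /andP[Bz _].
by have := le_lt_trans (le_trans Bz zx) xB; rewrite ltxx.
Qed.

(** Right continuity of the distribution function: []-oo, x]] is the intersection of the rays ending
    at [x + 1 / n.+1]. It makes the infimum that defines a quantile attained. *)
Lemma rho_right_closed (m x : R) :
  (forall e, 0 < e -> (m%:E <= rho `]-oo, (x + e)%R]%classic)%E) ->
  (m%:E <= rho `]-oo, x]%classic)%E.
Proof.
move=> h.
pose F (n : nat) : set (measurableTypeR R) := `]-oo, (x + n.+1%:R^-1)]%classic.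
have cF : rho (F n) @[n --> \oo] --> rho (\bigcap_n F n).
  apply: nonincreasing_cvg_mu => //.
  - by rewrite -ge0_fin_numE// fin_num_measure//; exact: measurable_itv.
  - by move=> n; exact: measurable_itv.
  - by apply: bigcap_measurable => // n _; exact: measurable_itv.
  - move=> n k nk; apply/subsetPset; apply: subset_itvl.
    by rewrite bnd_simp lerD2l lef_pV2 ?posrE ?ltr0n// ler_nat ltnS.
rewrite (itvNycEbigcap false); apply: cvge_ge cF.
by near=> n; rewrite h// invr_gt0.
Unshelve. all: by end_near. Qed.

(** The Galois connection between quantile and distribution function; monotonicity, measurability
    and the law of the quantile all follow from it. *)
Lemma real_quantile_le m x : 0 < m < 1 ->
  (real_quantile m <= x) = (m%:E <= rho `]-oo, x]%classic)%E.
Proof.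
move=> m01; have [m0 m1] := andP m01; rewrite /real_quantile in_itv/= m01.
apply/idP/idP => [mx|mx]; last first.
  by apply: ge_inf => //; exists (- B); exact: qset_lb.
apply: rho_right_closed => e e0.
have [|y /= ym ye] := @inf_adherent _ (quantile_set m) e e0.
  by split; [exists B; exact/qsetB/ltW | exists (- B); exact: qset_lb].
apply: le_trans ym _; rewrite le_measure ?inE//; apply: subset_itvl.
by rewrite bnd_simp; apply: le_trans (ltW ye) _; rewrite lerD2r.
Qed.

Lemma real_quantile_gt m x : 0 < m < 1 ->
  (x < real_quantile m) = (rho `]-oo, x]%classic < m%:E)%E.
Proof. by move=> m01; rewrite ltNge real_quantile_le// -ltNge. Qed.

Lemma real_quantile_nd m m' : 0 < m -> m <= m' -> m' < 1 ->
  real_quantile m <= real_quantile m'.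
Proof.
move=> m0 mm' m1; rewrite real_quantile_le ?m0 ?(le_lt_trans mm')//.
apply: (@le_trans _ _ m'%:E); first by rewrite lee_fin.
by rewrite -real_quantile_le ?m1 ?(lt_le_trans m0).
Qed.

Lemma real_quantileE m : 0 < m < 1 ->
  ereal_inf [set x%:E | x in quantile_set m] = (real_quantile m)%:E.
Proof.
move=> m01; have [m0 m1] := andP m01.
rewrite ereal_inf_EFin ?/real_quantile ?in_itv/= ?m01//; first by exists (- B); exact: qset_lb.
by exists B; exact/qsetB/ltW.
Qed.

Hypothesis B0 : 0 <= B.

Lemma real_quantile_bound m : `|real_quantile m| <= B.
Proof.
have [m01|m01] := boolP (m \in `]0, 1[); last by rewrite /real_quantile (negbTE m01) normr0.
move: m01; rewrite in_itv/= => m01; have [m0 m1] := andP m01.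
rewrite ler_norml real_quantile_le// (qsetB (ltW m1)) andbT.
rewrite /real_quantile in_itv/= m01; apply: lb_le_inf; last exact: qset_lb.
by exists B; exact/qsetB/ltW.
Qed.

(** The second set accounts for the junk value 0 outside []0, 1[]. *)
Let real_quantile_ray x : real_quantile @^-1` `]x, +oo[ =
  ([set m | (m \in `]0, 1[) && (fine (rho `]-oo, x]%classic) < m)]) `|`
  [set m | (m \notin `]0, 1[) && (x < 0)].
Proof.
apply/seteqP; split => m /=; rewrite !in_itv/= ?andbT.
  have [m01|m01] := boolP (0 < m < 1).
    by rewrite real_quantile_gt// -lte_fin fineK ?fin_num_measure//; left.
  by rewrite /real_quantile in_itv/= (negbTE m01); right.
move=> [/andP[m01]|/andP[m01]].
  by rewrite real_quantile_gt// -lte_fin fineK ?fin_num_measure.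
by rewrite /real_quantile in_itv/= (negbTE m01).
Qed.

Lemma real_quantile_measurable : measurable_fun [set: measurableTypeR R] real_quantile.
Proof.
move=> _; apply: (measurability _ (RGenOInfty.measurableE R)) => //.
move=> /= _ [_ [x ->] <-]; rewrite setTI real_quantile_ray; apply: measurableU.
  rewrite (_ : mkset _ = `]0, 1[%classic `&` `](fine (rho `]-oo, x]%classic)), +oo[%classic).
    exact: measurableI.
  by apply/seteqP; split => m /=; rewrite !in_itv/= andbT => /andP.
case: (x < 0); last first.
  by rewrite (_ : mkset _ = set0)//; apply/seteqP; split => m //=; rewrite andbF.
rewrite (_ : mkset _ = ~` `]0, 1[%classic); first exact: measurableC.
by apply/seteqP; split => m /=; rewrite andbT => /negP.
Qed.

Lemma real_quantile_bm : @bm R _ (measurableTypeR R) real_quantile.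
Proof. by split; [exact: real_quantile_measurable | exists B; exact: real_quantile_bound]. Qed.

(** Inverse transform sampling: on []0, 1[] the quantile exceeds [x] exactly beyond [F = rho ]-oo,
    x]], a set of uniform mass [1 - F], and right rays determine a law. *)
Lemma real_quantile_law (A : set (measurableTypeR R)) : measurable A ->
  unif (real_quantile @^-1` A) = rho A.
Proof.
have mqf : measurable_fun setT (real_quantile : measurableTypeR R -> measurableTypeR R).
  exact: real_quantile_measurable.
move=> mA; rewrite -(lawE unif mqf).
apply: (@measure_eq_rays R (law unif mqf) rho) => // x.
rewrite lawE; set F := fine (rho `]-oo, x]%classic).
have FE : rho `]-oo, x]%classic = F%:E by rewrite fineK ?fin_num_measure.
have F01 : 0 <= F <= 1.
  by rewrite -!lee_fin -FE measure_ge0 probability_le1.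
have -> : rho `]x, +oo[%classic = (1 - F)%:E.
  by rewrite EFinB -FE -probability_setC//; congr (rho _); rewrite setCitvl.
rewrite -unif_gt//; apply: (prob_eq _ unif_open) => //.
  by rewrite -[X in measurable X]setTI; exact: real_quantile_measurable.
move=> m /=; rewrite !in_itv/= !andbT => m01.
by rewrite real_quantile_gt// FE lte_fin.
Qed.

End real_quantile.

(** * Stop-loss comparison with the comonotone vector *)

Lemma le_add_divn {R : realType} (a b C : R) :
  (forall n : nat, a <= b + C / n.+1%:R) -> a <= b.
Proof.
move=> h; apply/ler_addgt0Pr => e e0.
apply: le_trans (h (Num.truncn (`|C| / e))) _; rewrite lerD2l.
rewrite ler_pdivrMr// mulrC -ler_pdivrMr//.
apply: le_trans (ltW (truncnS_gt _)).
by rewrite ler_pM2r ?invr_gt0// ler_norm.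
Qed.

Section stop_loss.
Context {R : realType} {d : nat}.
Variables (J : 'I_d -> set R) (f : ('I_d -> R) -> R).
Hypotheses (fmono : box_mono J f) (fid : increasing_differences J f).
Variable W : 'I_d -> R -> R.
Hypothesis WJ : forall i m, 0 < m < 1 -> J i (W i m).
Hypothesis Wnd : forall i m m', 0 < m -> m <= m' -> m' < 1 -> W i m <= W i m'.
Variable h : measurableTypeR R -> R.
Hypothesis bh : bm h.
Hypothesis hW : forall m, 0 < m < 1 -> h m = f (W ^~ m).

Lemma composite_nd m m' : 0 < m -> m <= m' -> m' < 1 -> h m <= h m'.
Proof.
move=> m0 mm' m1; have m01 : 0 < m < 1 by rewrite m0 (le_lt_trans mm').
have m01' : 0 < m' < 1 by rewrite m1 (lt_le_trans m0).
by rewrite !hW//; apply: fmono => i; [exact: WJ|exact: WJ|exact: Wnd].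
Qed.

Context {d0 : measure_display} {T : measurableType d0}.
Variables (P : probability T R) (X : 'I_d -> T -> R) (D : set T) (Z : T -> R).
Hypothesis mX : forall i, measurable_fun setT (X i).
Hypothesis XW : forall i t, 0 < t < 1 ->
  (P [set w | W i t < X i w]%R <= (1 - t)%:E)%E.
Hypotheses (mD : measurable D) (PD : P D = 1%E).
Hypothesis DX : forall w, D w -> in_box J (X ^~ w).
Hypotheses (bZ : bm Z) (ZX : forall w, D w -> Z w = f (X ^~ w)).

Section chain.
Variable t : nat -> R.
Hypotheses (t01 : forall k, 0 < t k < 1) (tS : forall k, t k <= t k.+1).

Let E_tail k i : E P (fun w => (W i (t k) < X i w)%R%:R) <= 1 - t k.
Proof.
rewrite -lee_fin ltr_indicE E_indic; last first.
  by rewrite -[X in measurable X]setTI; exact: mX.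
by have := XW i (t01 k); congr (P _ <= _)%E; rewrite preimage_itvoy.
Qed.

(** The expectation of [stop_loss_dual] along [y k = W(t k)]: each indicator costs at most
    [1 - t k], and the gains summed over [i] give back the increments of [h]. The last term pays for
    coordinates above the top of the chain. *)
Let stop_loss_chain_le (B : R) n : (forall w m, Z w - h m <= B) -> 0 <= B ->
  E P (fun w => Num.max (Z w - h (t 0%N)) 0) <=
  \sum_(k < n) (1 - t k) * (h (t k.+1) - h (t k)) + d%:R * (1 - t n) * B.
Proof.
move=> ZhB B0; pose y k i := W i (t k).
have Jy k : in_box J (y k) by move=> i; exact: WJ.
have yS k i : y k i <= y k.+1 i.
  by apply: Wnd => //; [case/andP: (t01 k)|case/andP: (t01 k.+1)].
have hy k : h (t k) = f (y k) by exact: hW.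
have bl k i : bm (fun w => (y k i < X i w)%R%:R : R) by exact: bm_lt.
pose r1 w := \sum_(k < n) \sum_(i < d) (y k i < X i w)%R%:R * step_gain f (y k) (y k.+1) i.
pose r2 w := \sum_(i < d) (y n i < X i w)%R%:R * B.
have b1 : bm r1.
  by apply: bm_sum => k; apply: bm_sum => i; apply: bmM => //; exact: bm_cst.
have b2 : bm r2.
  by apply: bm_sum => i; apply: bmM => //; exact: bm_cst.
apply: (@le_trans _ _ (E P (fun w => r1 w + r2 w))).
  apply: (E_le mD PD) => [||w Dw].
  - by apply: bm_max; [apply: bmB => //|]; exact: bm_cst.
  - exact: bmD.
  - rewrite ZX// hy; apply: (stop_loss_dual fmono fid) => //; first exact: DX.
    by rewrite -ZX// -hy.
rewrite ED//; apply: lerD.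
  rewrite E_sum; last by move=> k; apply: bm_sum => i; apply: bmM => //; exact: bm_cst.
  apply: ler_sum => k _; rewrite E_sum; last by move=> i; apply: bmM => //; exact: bm_cst.
  rewrite !hy -step_gain_sum mulr_sumr; apply: ler_sum => i _.
  under [X in E P X]eq_fun do rewrite mulrC.
  rewrite EZ// mulrC ler_wpM2r//; first exact: (step_gain_ge0 fmono).
  exact: E_tail.
rewrite E_sum; last by move=> i; apply: bmM => //; exact: bm_cst.
apply: (@le_trans _ _ (\sum_(i < d) (1 - t n) * B)).
  apply: ler_sum => i _; under [X in E P X]eq_fun do rewrite mulrC.
  by rewrite EZ// mulrC ler_wpM2r//; exact: E_tail.
by rewrite sumr_const card_ord -[leLHS]mulr_natl mulrA.
Qed.

Let telescope_chain n :
  h (t n) - h (t 0%N) = \sum_(k < n) (h (t k.+1) - h (t k)).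
Proof.
rewrite -(big_mkord xpredT (fun k : nat => h (t k.+1) - h (t k))).
by rewrite (telescope_sumr (fun k : nat => h (t k))).
Qed.

(** The increments that count are those ending at or below [m]; they telescope up to the last level
    not exceeding [m]. *)
Let riemann_pointwise n m : 0 < m < 1 ->
  \sum_(k < n) (t k.+1 <= m)%R%:R * (h (t k.+1) - h (t k)) <= Num.max (h m - h (t 0%N)) 0.
Proof.
move=> m01; elim: n => [|n ih]; first by rewrite big_ord0 le_max lexx orbT.
rewrite big_ord_recr/=; have [tm|tm] := leP (t n.+1) m; last by rewrite mul0r addr0.
have tle k : (k <= n)%N -> t k.+1 <= m.
  move=> kn; apply: le_trans tm; rewrite -(subnK kn).
  by elim: (n - k)%N => [//|j jh]; rewrite (le_trans jh)// addSn.
apply: (@le_trans _ _ (h (t n.+1) - h (t 0%N))); last first.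
  by rewrite le_max lerD2r composite_nd//; [case/andP: (t01 n.+1)|case/andP: m01].
rewrite telescope_chain big_ord_recr/= mul1r lerD2r.
by apply: ler_sum => k _; rewrite tle ?mul1r// ltnW.
Qed.

Let riemann_le n : \sum_(k < n) (1 - t k.+1) * (h (t k.+1) - h (t k)) <=
  E unif (fun m => Num.max (h m - h (t 0%N)) 0).
Proof.
have bge k : bm (fun m : measurableTypeR R => (t k <= m)%R%:R : R).
  rewrite (_ : (fun _ => _) = \1_(`[t k, +oo[%classic)); first exact: bm_indic.
  by apply/funext => m; rewrite indicE; congr (_%:R); congr nat_of_bool;
    apply/idP/idP; rewrite inE/= in_itv/= andbT.
apply: (@le_trans _ _ (E unif (fun m : measurableTypeR R =>
    \sum_(k < n) (t k.+1 <= m)%R%:R * (h (t k.+1) - h (t k))))).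
  rewrite E_sum; last by move=> k; apply: bmM => //; exact: bm_cst.
  apply: ler_sum => k _; under [X in E _ X]eq_fun do rewrite mulrC.
  rewrite EZ// mulrC ler_wpM2l//.
    by rewrite subr_ge0 composite_nd//; [case/andP: (t01 k)|case/andP: (t01 k.+1)].
  rewrite -lee_fin (_ : (fun _ => _) = \1_(`[t k.+1, +oo[%classic)).
    rewrite E_indic// unif_ge//; have /andP[? ?] := t01 k.+1.
    by apply/andP; split; exact: ltW.
  by apply/funext => m; rewrite indicE; congr (_%:R); congr nat_of_bool;
    apply/idP/idP; rewrite inE/= in_itv/= andbT.
apply: (E_le _ unif_open) => //.
- by apply: bm_sum => k; apply: bmM => //; exact: bm_cst.
- by apply: bm_max; [apply: bmB => //|]; exact: bm_cst.
- by move=> m /=; rewrite in_itv/=; exact: riemann_pointwise.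
Qed.

(** The upper sum of [stop_loss_chain_le] has weights [1 - t k], the lower sum of [riemann_le] has
    weights [1 - t k.+1]; they differ by at most the mesh [e] times the total increment of [h]. *)
Lemma stop_loss_chain (B e : R) n : (forall w m, Z w - h m <= B) -> 0 <= B ->
  (forall k, t k.+1 - t k <= e) ->
  E P (fun w => Num.max (Z w - h (t 0%N)) 0) <=
  E unif (fun m => Num.max (h m - h (t 0%N)) 0)
   + e * (h (t n) - h (t 0%N)) + d%:R * (1 - t n) * B.
Proof.
move=> ZhB B0 te; apply: le_trans (stop_loss_chain_le n ZhB B0) _.
rewrite lerD2r telescope_chain mulr_sumr.
apply: le_trans (lerD (riemann_le n) (lexx _)); rewrite -big_split/=.
apply: ler_sum => k _; rewrite -mulrDl ler_wpM2r//.
  by rewrite subr_ge0 composite_nd//; [case/andP: (t01 k)|case/andP: (t01 k.+1)].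
by have := te k; lra.
Qed.

End chain.

Lemma stop_loss (t : R) : 0 < t < 1 ->
  E P (fun w => Num.max (Z w - h t) 0) <= E unif (fun m => Num.max (h m - h t) 0).
Proof.
move=> /andP[t0 t1].
have [B1 ZB] := bZ.2; have [B2 hB] := bh.2.
have [w0 _] : exists w, D w.
  apply/set0P/eqP => D0; move: PD; rewrite D0 measure0 => /eqP.
  by rewrite eq_sym onee_eq0.
have B10 : 0 <= B1 by exact: le_trans (normr_ge0 _) (ZB w0).
have B20 : 0 <= B2 by exact: le_trans (normr_ge0 _) (hB 0).
(* [2 * B2] bounds the total increment of [h], multiplied by the mesh; [d%:R * (B1 + B2)] comes from
   the top of the chain, where [1 - s n] is [(1 - t) / n.+1%:R]. *)
apply: (@le_add_divn _ _ _ (2 * B2 + d%:R * (B1 + B2))) => n.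
(* Dividing by [n.+1] keeps the level [s n] below 1; [minn] freezes the chain after index [n], since
   it is indexed by all of [nat]. *)
pose s k := t + (minn k n)%:R * ((1 - t) / n.+1%:R).
have n0 : 0 < n.+1%:R :> R by rewrite ltr0n.
have st : s 0%N = t by rewrite /s min0n mul0r addr0.
have c0 : 0 <= (1 - t) / n.+1%:R by rewrite divr_ge0// subr_ge0 ltW.
have s01 k : 0 < s k < 1.
  apply/andP; split.
    by rewrite ltr_wpDr// mulr_ge0.
  rewrite /s -ltrBrDl mulrCA gtr_pMr ?subr_gt0// ltr_pdivrMr// mul1r ltr_nat ltnS.
  exact: geq_minr.
have sS k : s k <= s k.+1.
  rewrite lerD2l ler_wpM2r// ler_nat.
  by rewrite leq_min geq_minr andbT (leq_trans (geq_minl _ _)).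
have ZhB w m : Z w - h m <= B1 + B2.
  rewrite lerD//; first exact: le_trans (ler_norm _) (ZB w).
  by rewrite lerNl; have := hB m; rewrite ler_norml => /andP[].
have se k : s k.+1 - s k <= n.+1%:R^-1.
  rewrite /s opprD addrACA subrr add0r -mulrBl.
  apply: (@le_trans _ _ (1 * (1 / n.+1%:R))); last by rewrite !mul1r.
  apply: ler_pM.
  - by rewrite subr_ge0 ler_nat leq_min geq_minr andbT (leq_trans (geq_minl _ _)).
  - exact: c0.
  - by rewrite lerBlDr nat1r ler_nat -minnSS leq_min geq_minl (leq_trans (geq_minr _ _)).
  - rewrite ler_pM2r ?invr_gt0//; lra.
have := stop_loss_chain s01 sS n ZhB (addr_ge0 B10 B20) se.
rewrite st => /le_trans; apply; rewrite -addrA lerD2l mulrDl; apply: lerD.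
  rewrite mulrC ler_wpM2r ?invr_ge0//.
  have := hB (s n); have := hB t; rewrite !ler_norml => /andP[h1 h2] /andP[h3 h4].
  lra.
have -> : 1 - s n = (1 - t) / n.+1%:R.
  rewrite /s minnn -[in RHS]natr1; field. by rewrite natr1 gt_eqF.
rewrite [leLHS](_ : _ = d%:R * (B1 + B2) / n.+1%:R * (1 - t)); last by ring.
by rewrite ler_piMr ?divr_ge0 ?mulr_ge0 ?addr_ge0//; lra.
Qed.

End stop_loss.

(** * Spectral risk *)

(** The sum counts the integers from 1 to [K] that do not exceed [x], hence is the integer part of
    [x]. Applied to a multiple of [a m], it approximates [a] by superlevel indicators. *)
Lemma sum_levels {R : realType} (x : R) (K : nat) : 0 <= x <= K%:R ->
  let s := \sum_(k < K) (k.+1%:R <= x)%R%:R in s <= x <= s + 1.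
Proof.
move=> /andP[x0 xK].
(* The induction needs the exact value of the sum as long as [K'] has not passed [x]. *)
suff H : forall K' : nat, let s := \sum_(k < K') (k.+1%:R <= x)%R%:R in
    if K'%:R <= x then s = K'%:R else s <= x <= s + 1.
  have /= := H K; case: ifP => [Kx ->|_ //].
  by rewrite (le_anti (introT andP (conj xK Kx))) lexx/= lerDl ler01.
elim=> [|k]; first by rewrite big_ord0 x0.
rewrite big_ord_recr/=; have [kx ih|kx ih] := leP k.+1%:R x.
  have kx' : k%:R <= x by apply: le_trans kx; rewrite ler_nat.
  by move: ih; rewrite /= kx' => ->; rewrite natr1.
rewrite addr0; move: ih => /=; case: ifP => // kx' ->.
by rewrite kx' natr1 ltW.
Qed.

Section spectral.
Context {R : realType}.
Variables q h : measurableTypeR R -> R.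
Hypotheses (bq : bm q) (bh : bm h).
Hypothesis hnd : forall m m', 0 < m -> m <= m' -> m' < 1 -> h m <= h m'.
Hypothesis qh : forall t, 0 < t < 1 ->
  E unif (fun m => Num.max (q m - h t) 0) <= E unif (fun m => Num.max (h m - h t) 0).

Let ge1 (t : R) : measurableTypeR R -> R := \1_(`[t, +oo[%classic).

Let ge1E t m : ge1 t m = (t <= m)%R%:R.
Proof.
rewrite /ge1 indicE; congr (_%:R); congr nat_of_bool.
by apply/idP/idP; rewrite inE/= in_itv/= andbT.
Qed.

Let bm_ge1 t : bm (ge1 t). Proof. exact: bm_indic. Qed.

Let E_ge1 t : 0 <= t <= 1 -> E unif (ge1 t) = 1 - t.
Proof. by move=> t01; apply: EFin_inj; rewrite E_indic// unif_ge. Qed.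

(** Beyond [t] the positive part for [h] is [h m - h t] itself, and before [t] it vanishes; the
    positive part for [q] only increases the right-hand side. The stop-loss comparison at level
    [h t] then bounds the tail. *)
Let tail_le t : 0 < t < 1 -> E unif (fun m => (q m - h m) * ge1 t m) <= 0.
Proof.
move=> t01; have [t0 t1] := andP t01; have bc := bm_cst (h t).
have bqt : bm (fun m => Num.max (q m - h t) 0).
  by apply: bm_max; [exact: bmB|exact: bm_cst].
have bht : bm (fun m => Num.max (h m - h t) 0).
  by apply: bm_max; [exact: bmB|exact: bm_cst].
apply: (@le_trans _ _ (E unif (fun m => Num.max (q m - h t) 0 - Num.max (h m - h t) 0))).
  apply: (E_le _ unif_open) => //.
  - by apply: bmM => //; exact: bmB.
  - exact: bmB.
  move=> m /=; rewrite in_itv/= ge1E => /andP[m0 m1]; have [tm|mt] := leP t m.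
    rewrite mulr1 (max_l (_ : 0 <= h m - h t)) ?subr_ge0 ?hnd//.
    have : q m - h t <= Num.max (q m - h t) 0 by rewrite le_max lexx.
    lra.
  have hmt : h m - h t <= 0 by rewrite subr_le0; apply: hnd => //; exact: ltW.
  by rewrite mulr0 (max_r hmt) subr0 le_max lexx orbT.
by rewrite EB// subr_le0 qh.
Qed.

(** Inside []0, 1[] such a set is an upper interval starting at its infimum [t], possibly 0 and
    possibly excluded. [tail_le] is therefore used at a slightly larger [t'], at a cost of at most
    [C * (t' - t)]. *)
Let upset_le (A : set (measurableTypeR R)) : measurable A ->
  (forall m m', 0 < m -> m <= m' -> m' < 1 -> A m -> A m') ->
  E unif (fun m => (q m - h m) * \1_A m) <= 0.
Proof.
move=> mA upA; have b1 : bm (\1_A : _ -> R) by exact: bm_indic.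
have bqh : bm (fun m => q m - h m) by exact: bmB.
have bqhA : bm (fun m => (q m - h m) * \1_A m) by exact: bmM.
pose S := [set m : R | 0 < m < 1 /\ A m].
have [S0|/set0P[m0 [m001 Am0]]] := eqVneq S set0.
  rewrite -[leRHS](E_cst unif 0); apply: (E_le _ unif_open) => //; first exact: bm_cst.
  move=> m /=; rewrite in_itv/= => m01; rewrite indicE memNset ?mulr0// => Am.
  by have : S m by []; rewrite S0.
have S_lb : lbound S 0 by move=> m [/andP[/ltW]].
have hlS : has_lbound S by exists 0.
pose t := inf S.
have t0 : 0 <= t by apply: lb_le_inf => //; exists m0.
have t1 : t < 1.
  apply: (@le_lt_trans _ _ m0); last by case/andP: m001.
  exact: ge_inf.
have [C qhC] := bqh.2.
have C0 : 0 <= C by exact: le_trans (normr_ge0 _) (qhC 0).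
apply/ler_addgt0Pr => e e0; rewrite add0r.
(* Strictly above [t], so that [A] contains everything from [t'] up to 1; the midpoint keeps [t']
   below 1, and [C + 1] avoids a division by zero. *)
pose t' := Num.min (t + e / (C + 1)) ((t + 1) / 2).
have C1 : 0 < C + 1 by rewrite ltr_wpDl.
have tt' : t < t' by rewrite lt_min ltrDl divr_gt0//=; lra.
have t'1 : t' < 1 by rewrite gt_min; apply/orP; right; lra.
have t'01 : 0 < t' < 1 by rewrite t'1 (le_lt_trans t0 tt').
apply: (@le_trans _ _ (E unif (fun m => (q m - h m) * ge1 t' m + C * (ge1 t m - ge1 t' m)))).
  have bg : bm (fun m => ge1 t m - ge1 t' m) by exact: bmB.
  apply: (E_le _ unif_open) => //.
    by apply: bmD; [exact: bmM | exact: bmZ].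
  move=> m /=; rewrite in_itv/= !ge1E => m01.
  have [m0' m1'] := andP m01.
  have := qhC m; rewrite ler_norml => /andP[C1' C2'].
  have [t'm|mt'] := leP t' m.
    have -> : t <= m by rewrite (le_trans (ltW tt')).
    rewrite indicE mem_set ?mulr1 ?subrr ?mulr0 ?addr0//.
    have [s [s01 As] sm] := @inf_lt _ S _ (ex_intro _ m0 (conj m001 Am0)) (lt_le_trans tt' t'm).
    by apply: upA As => //; [case/andP: s01 | exact: ltW].
  rewrite mulr0 add0r subr0; have [tm|mt] := leP t m.
    by rewrite mulr1 indicE; case: (_ \in _); rewrite ?mulr1// mulr0.
  rewrite mulr0 indicE memNset ?mulr0// => Am.
  have : t <= m by apply: ge_inf.
  by rewrite leNgt mt.
have bg : bm (fun m => ge1 t m - ge1 t' m) by exact: bmB.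
rewrite ED//; [|exact: bmM|exact: bmZ].
have Et : E unif (ge1 t) = 1 - t by apply: E_ge1; rewrite t0 ltW.
have Et' : E unif (ge1 t') = 1 - t'.
  by apply: E_ge1; have /andP[? ?] := t'01; rewrite !ltW.
rewrite EZ// EB// Et Et'.
rewrite -[e]add0r lerD ?tail_le//.
apply: (@le_trans _ _ (C * (e / (C + 1)))).
  apply: ler_wpM2l => //.
  have : t' <= t + e / (C + 1) by rewrite ge_min lexx.
  lra.
rewrite mulrA ler_pdivrMr// mulrC ler_wpM2l ?ltW//; lra.
Qed.

(** Superlevel sets of the nondecreasing [a] are closed upwards, so [upset_le] handles each layer.
    With layers of height [1 / N] the rounding error is at most [C / N]; [M] bounds the number of
    layers. *)
Lemma spectral_le (a : measurableTypeR R -> R) (M : R) : bm a ->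
  (forall m, 0 < m < 1 -> 0 <= a m <= M) ->
  (forall m m', 0 < m -> m <= m' -> m' < 1 -> a m <= a m') ->
  E unif (fun m => q m * a m) <= E unif (fun m => h m * a m).
Proof.
move=> ba aM and_; have bqh : bm (fun m => q m - h m) by exact: bmB.
have [C qhC] := bqh.2.
have C0 : 0 <= C by exact: le_trans (normr_ge0 _) (qhC 0).
have bqa : bm (fun m => q m * a m) by exact: bmM.
have bha : bm (fun m => h m * a m) by exact: bmM.
rewrite -subr_le0 -EB//; apply: (@le_add_divn _ _ _ C) => n; rewrite add0r.
set N : R := n.+1%:R; have N0 : 0 < N by rewrite ltr0n.
have M0 : 0 <= M.
  have /aM/andP[] : 0 < (2^-1 : R) < 1 by lra.
  exact: le_trans.
pose K := (Num.truncn (N * M)).+1.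
have MK : N * M <= K%:R by exact/ltW/truncnS_gt.
pose A k : set (measurableTypeR R) := [set m | k.+1%:R / N <= a m].
have mA k : measurable (A k).
  rewrite (_ : A k = a @^-1` `[k.+1%:R / N, +oo[); last first.
    by apply/seteqP; split => m /=; rewrite in_itv/= andbT.
  by rewrite -[X in measurable X]setTI; apply: ba.1.
have bA k : bm (fun m => (q m - h m) * \1_(A k) m) by apply: bmM => //; exact: bm_indic.
pose r m := \sum_(k < K) N^-1 * ((q m - h m) * \1_(A k) m).
have br : bm r by apply: bm_sum => k; exact: bmZ.
apply: (@le_trans _ _ (E unif (fun m => r m + C / N))).
  apply: (E_le _ unif_open) => //; first exact: bmB.
    by apply: bmD => //; exact: bm_cst.
  move=> m /=; rewrite in_itv/= => m01; have /andP[am0 aMm] := aM _ m01.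
  have := @sum_levels R (N * a m) K.
  rewrite mulr_ge0 ?(ltW N0)//= (le_trans _ MK) ?ler_pM2l// => /(_ isT).
  rewrite /r -mulr_sumr -mulr_sumr.
  have -> : \sum_(k < K) (k.+1%:R <= N * a m)%R%:R = \sum_(k < K) \1_(A k) m :> R.
    apply: eq_bigr => k _; rewrite indicE; congr (_%:R); congr nat_of_bool.
    by apply/idP/idP; rewrite inE/= /A/= ler_pdivrMr// mulrC.
  set s := \sum_(k < K) _ => /andP[s1 s2].
  have -> : q m * a m - h m * a m = (q m - h m) * (a m - N^-1 * s) + N^-1 * ((q m - h m) * s).
    by ring.
  rewrite addrC lerD2l; apply: le_trans (ler_norm _) _; rewrite normrM.
  apply: ler_pM => //; rewrite ger0_norm.
    by rewrite lerBlDl -(ler_pM2l N0) mulrDr mulVKf ?gt_eqF// divff ?gt_eqF// .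
  by rewrite subr_ge0 -(ler_pM2l N0) mulVKf ?gt_eqF.
rewrite ED//; last exact: bm_cst.
rewrite E_cst gerDr E_sum; last by move=> k; exact: bmZ.
apply: sumr_le0 => k _; rewrite EZ// pmulr_rle0 ?invr_gt0//.
apply: upset_le => // m m' m0 mm' m1; rewrite /A/= => /le_trans; apply.
exact: and_.
Qed.

End spectral.

(** * Quantiles of a law and optimality of the comonotone vector *)

(** [J] may miss its endpoints. If the quantile at [m] were outside [J], the interval would lie
    entirely on one side of it; then only levels below [m], or only levels above [m], could have
    their quantile in [J], and [J] would have mass at most [m] or [1 - m]. *)
Lemma real_quantile_in {R : realType} (rho : probability (measurableTypeR R) R) (B : R)
  (J : set R) m : rho `[- B, B]%classic = 1%E -> 0 <= B -> is_interval J ->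
  rho J = 1%E -> 0 < m < 1 -> J (real_quantile rho m).
Proof.
move=> rhoB B0 iJ rhoJ m01; apply: contrapT => nJ.
have mJ : measurable (J : set (measurableTypeR R)) by exact: is_interval_measurable.
have [m0 m1] := andP m01.
have mq := real_quantile_measurable rhoB.
have mqJ : measurable (real_quantile rho @^-1` J).
  by rewrite -[X in measurable X]setTI; exact: mq.
have : unif (real_quantile rho @^-1` J) = 1%E by rewrite (real_quantile_law rhoB).
have [below|above] : (forall y, J y -> y < real_quantile rho m) \/
    (forall y, J y -> real_quantile rho m < y).
- apply: contrapT => /not_orP[/existsNP[y /not_implyP[Jy /negP]]].
  rewrite -leNgt => qy /existsNP[z /not_implyP[Jz /negP]]; rewrite -leNgt => zq.
  by apply: nJ; apply: (iJ z y) => //; rewrite zq qy.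
- have : (unif (real_quantile rho @^-1` J) <= unif (~` `[m, +oo[))%E.
    rewrite -(E_indic unif mqJ) -(E_indic unif (measurableC _))// lee_fin.
    apply: (E_le _ unif_open) => //; [exact: bm_indic|exact/bm_indic/measurableC|].
    move=> x /=; rewrite in_itv/= => /andP[x0 x1]; rewrite !indicE ler_nat.
    have [xJ|] := boolP (x \in real_quantile rho @^-1` J) => //.
    rewrite mem_set//= in_itv/= andbT => mx.
    move: xJ; rewrite inE/= => /below.
    by rewrite ltNge (real_quantile_nd rhoB m0 mx x1).
  rewrite probability_setC// unif_ge; last by rewrite !ltW.
  by move=> /[swap] ->; rewrite -EFinB lee_fin; lra.
- have : (unif (real_quantile rho @^-1` J) <= unif `]m, +oo[%classic)%E.
    rewrite -(E_indic unif mqJ) -(E_indic unif (measurable_itv _))// lee_fin.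
    apply: (E_le _ unif_open) => //; [exact: bm_indic|exact: bm_indic|].
    move=> x /=; rewrite in_itv/= => /andP[x0 x1]; rewrite !indicE ler_nat.
    have [xJ|] := boolP (x \in real_quantile rho @^-1` J) => //.
    rewrite mem_set//= in_itv/= andbT ltNge; apply/negP => xm.
    move: xJ; rewrite inE/= => /above.
    by rewrite ltNge (real_quantile_nd rhoB x0 xm m1).
  rewrite unif_gt; last by rewrite !ltW.
  by move=> /[swap] ->; rewrite lee_fin; lra.
Qed.

(** An inequality only, because the law may have an atom at its quantile. *)
Lemma real_quantile_tail {R : realType} (rho : probability (measurableTypeR R) R) (B t : R) :
  rho `[- B, B]%classic = 1%E -> 0 < t < 1 ->
  (rho `](real_quantile rho t), +oo[%classic <= (1 - t)%:E)%E.
Proof.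
move=> rhoB t01.
have -> : `](real_quantile rho t), +oo[%classic =
    ~` `]-oo, (real_quantile rho t)]%classic by rewrite setCitvl.
rewrite probability_setC// EFinB; apply: leeB => //.
by rewrite -(real_quantile_le rhoB).
Qed.

Lemma law_bounded {R : realType} d0 (T : measurableType d0) (P : probability T R)
  (Z : T -> measurableTypeR R) (mZ : measurable_fun setT Z) (B : R) :
  (forall w, `|Z w| <= B) -> law P mZ `[- B, B]%classic = 1%E.
Proof.
move=> ZB; rewrite lawE -(probability_setT P); congr (P _).
by apply/seteqP; split => // w _ /=; rewrite in_itv/= -ler_norml.
Qed.

Lemma E_real_quantile {R : realType} d0 (T : measurableType d0) (P : probability T R)
  (Z : T -> measurableTypeR R) (mZ : measurable_fun setT Z) (B : R)
  (phi : measurableTypeR R -> R) :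
  (forall w, `|Z w| <= B) -> 0 <= B -> measurable_fun setT phi ->
  (exists C, forall x, `|x| <= B -> `|phi x| <= C) ->
  E unif (phi \o real_quantile (law P mZ)) = E P (phi \o Z).
Proof.
move=> ZB B0 mphi [C phiC]; have rB := law_bounded P mZ ZB.
(* [phi] is controlled only on the range of [Z]; cutting it off makes it bounded everywhere without
   changing either side. *)
pose psi := phi \_ `[- B, B]%classic.
have bpsi : bm psi.
  split.
    by apply/(measurable_restrictT _ _).1 => //; exact: measurable_funTS.
  exists `|C| => x; rewrite /psi patchE; case: ifPn; last by rewrite normr0.
  rewrite inE/= in_itv/= -ler_norml => /phiC xC; apply: le_trans xC _.
  exact: ler_norm.
have psiE x : `|x| <= B -> psi x = phi x.
  by move=> xB; rewrite /psi patchE mem_set//= in_itv/= -ler_norml.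
have -> : phi \o real_quantile (law P mZ) = psi \o real_quantile (law P mZ).
  by apply/funext => m /=; rewrite psiE//; exact: (real_quantile_bound rB).
have -> : phi \o Z = psi \o Z by apply/funext => m /=; rewrite psiE.
have mq : measurable_fun setT
    (real_quantile (law P mZ) : measurableTypeR R -> measurableTypeR R).
  exact: (real_quantile_measurable rB).
apply: E_same_law => // A mA.
by rewrite (real_quantile_law rB)// lawE.
Qed.

Section optimality.
Context {R : realType} {d : nat}.
Variables (J : 'I_d -> set R) (f : ('I_d -> R) -> R).
Hypotheses (fmono : box_mono J f) (fid : increasing_differences J f).
Variable W : 'I_d -> R -> R.
Hypothesis WJ : forall i m, 0 < m < 1 -> J i (W i m).
Hypothesis Wnd : forall i m m', 0 < m -> m <= m' -> m' < 1 -> W i m <= W i m'.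
Variable h : measurableTypeR R -> R.
Hypothesis bh : bm h.
Hypothesis hW : forall m, 0 < m < 1 -> h m = f (W ^~ m).
Context {d0 : measure_display} {T : measurableType d0}.
Variables (P : probability T R) (X : 'I_d -> T -> R) (D : set T)
  (Z : T -> measurableTypeR R).
Hypothesis mX : forall i, measurable_fun setT (X i).
Hypothesis XW : forall i t, 0 < t < 1 ->
  (P [set w | W i t < X i w]%R <= (1 - t)%:E)%E.
Hypotheses (mD : measurable D) (PD : P D = 1%E).
Hypothesis DX : forall w, D w -> in_box J (X ^~ w).
Hypotheses (bZ : bm (Z : T -> R)) (ZX : forall w, D w -> Z w = f (X ^~ w)).

Lemma spectral_opt (mZ : measurable_fun setT Z) (a : measurableTypeR R -> R) (M : R) :
  bm a -> (forall m, 0 < m < 1 -> 0 <= a m <= M) ->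
  (forall m m', 0 < m -> m <= m' -> m' < 1 -> a m <= a m') ->
  E unif (fun m => real_quantile (law P mZ) m * a m) <= E unif (fun m => h m * a m).
Proof.
move=> ba aM and_; have [C ZC] := bZ.2.
pose B := `|C|; have B0 : 0 <= B by exact: normr_ge0.
have ZB w : `|Z w| <= B by apply: le_trans (ZC w) _; exact: ler_norm.
have rB := law_bounded P mZ ZB.
apply: (spectral_le _ bh _ _ ba aM and_) => //.
- exact: (real_quantile_bm rB).
- exact: (composite_nd fmono WJ Wnd hW).
move=> t t01; have := stop_loss fmono fid WJ Wnd bh hW mX XW mD PD DX bZ ZX t01.
apply: le_trans; pose phi (x : measurableTypeR R) : R := Num.max (x - h t) 0.
rewrite -/(phi \o real_quantile (law P mZ)) -/(phi \o Z) (E_real_quantile P mZ ZB B0)//.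
  by apply: measurable_maxr => //; exact: measurable_funB.
exists (B + `|h t|) => x xB; rewrite /phi.
have [_|_] := leP (x - h t) 0; first by rewrite normr0 addr_ge0.
by apply: le_trans (ler_normB _ _) _; rewrite lerD2r.
Qed.

(** With weight 1 the risk is the mean; this case serves the transport cost. *)
Lemma mean_opt : E P Z <= E unif h.
Proof.
have mZ : measurable_fun setT Z by exact: bZ.1.
have := @spectral_opt mZ (fun=> 1) 1 (bm_cst 1).
have e (g : measurableTypeR R -> R) : (fun m => g m * 1) = g.
  by apply/funext => m; rewrite mulr1.
rewrite !e => qh.
have [C ZC] := bZ.2.
pose B := `|C|; have B0 : 0 <= B by exact: normr_ge0.
have ZB w : `|Z w| <= B by apply: le_trans (ZC w) _; exact: ler_norm.
have := @E_real_quantile _ _ _ P _ mZ B id ZB B0 (@measurable_id _ _ _).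
rewrite /comp /= => <-; last by exists B.
by apply: qh => // m _; rewrite ler01 lexx.
Qed.

End optimality.

(** [h] may differ at its jumps from the quantile [q] of its own law. But [q <= h] on []0, 1[],
    because [h] is at most [h m] on a set of mass at least [m]; as both have the same mean, the
    integral of [(h - q) * a] is at most [M] times zero. *)
Lemma spectral_attained {R : realType} (h : measurableTypeR R -> measurableTypeR R)
  (mh : measurable_fun setT h) (a : measurableTypeR R -> R) (M : R) :
  bm (h : measurableTypeR R -> R) -> bm a ->
  (forall m m', 0 < m -> m <= m' -> m' < 1 -> h m <= h m') ->
  (forall m, 0 < m < 1 -> 0 <= a m <= M) ->
  E unif (fun m => real_quantile (law unif mh) m * a m) = E unif (fun m => h m * a m).
Proof.
move=> bh ba hnd aM; have [C hC] := bh.2.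
pose B := `|C|; have B0 : 0 <= B by exact: normr_ge0.
have hB w : `|h w| <= B by apply: le_trans (hC w) _; exact: ler_norm.
have rB := law_bounded unif mh hB.
pose q := real_quantile (law unif mh); have bq : bm q by exact: (real_quantile_bm rB).
have qh m : 0 < m < 1 -> q m <= h m.
  move=> m01; have /andP[m0 m1] := m01; rewrite (real_quantile_le rB)// lawE.
  have mA : measurable (h @^-1` `]-oo, (h m)]).
    by rewrite -[X in measurable X]setTI; move: (mh); apply.
  have -> : m%:E = unif (~` `]m, +oo[%classic).
    rewrite probability_setC// unif_gt; last by rewrite !ltW.
    by rewrite -EFinB; congr EFin; ring.
  rewrite -(E_indic unif mA) -(E_indic unif (measurableC _))// lee_fin.
  apply: (E_le _ unif_open) => //; [exact/bm_indic/measurableC|exact: bm_indic|].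
  move=> x /=; rewrite in_itv/= => /andP[x0 x1]; rewrite !indicE ler_nat.
  have [|//] := boolP (x \in ~` `]m, +oo[%classic).
  rewrite inE/= in_itv/= andbT => /negP; rewrite -leNgt => xm.
  by rewrite mem_set//= in_itv/= hnd.
have Eqh : E unif q = E unif h.
  have := @E_real_quantile _ _ _ unif _ mh B id hB B0 (@measurable_id _ _ _).
  by apply; exists B.
apply/eqP; rewrite eq_le; apply/andP; split.
  apply: (E_le _ unif_open) => //; [exact: bmM|exact: bmM|].
  move=> m /=; rewrite in_itv/= => m01; have /andP[a0 _] := aM _ m01.
  by rewrite ler_wpM2r// qh.
have bha : bm (fun m => h m * a m) by exact: bmM.
have bqa : bm (fun m => q m * a m) by exact: bmM.
rewrite -subr_le0 -EB//; apply: (@le_trans _ _ (E unif (fun m => M * (h m - q m)))).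
  apply: (E_le _ unif_open) => //; [exact: bmB|exact/bmZ/bmB|].
  move=> m /=; rewrite in_itv/= => m01; have /andP[a0 a1] := aM _ m01.
  by rewrite -mulrBl mulrC ler_wpM2r// subr_ge0 qh.
by rewrite EZ ?EB// -?Eqh ?subrr ?mulr0//; exact: bmB.
Qed.

(** * Wasserstein distance on the line *)

Section power_cost.
Context {R : realType}.
Variable p : R.
Hypothesis p1 : 1 <= p.
Let g (x : R) : R := `|x| `^ p.

Let p0 : 0 <= p. Proof. exact: le_trans p1. Qed.

Let g_convex (l x y : R) : 0 <= l <= 1 ->
  g ((1 - l) * x + l * y) <= (1 - l) * g x + l * g y.
Proof.
move=> /andP[l0 l1]; have l0' : 0 <= 1 - l by rewrite subr_ge0.
have l1' : 1 - l <= 1 by rewrite gerBl.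
apply: (@le_trans _ _ (((1 - l) * `|x| + l * `|y|) `^ p)).
  apply: ge0_ler_powR => //; rewrite ?nnegrE ?addr_ge0 ?mulr_ge0//.
  by rewrite (le_trans (ler_normD _ _))// !normrM (ger0_norm l0) (ger0_norm l0').
have := @convex_powR R p p1 (Itv01 l0' l1') `|x| `|y|.
rewrite !inE/= !in_itv/= !andbT => /(_ (normr_ge0 _) (normr_ge0 _)).
rewrite convRE [X in (X `^ _ <= _) -> _]convRE/= /unstable.onem.
by rewrite (_ : 1 - (1 - l) = l)//; ring.
Qed.

Let g_increments (x y h : R) : x <= y -> 0 <= h -> g (x + h) + g y <= g x + g (y + h).
Proof.
move=> xy h0; have [s0|s0] := eqVneq (y - x + h) 0.
  have [-> ->] : y = x /\ h = 0 by lra.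
  by rewrite addr0.
have s0' : 0 < y - x + h by rewrite lt_neqAle eq_sym s0/=; lra.
(* With this weight [x + h] and [y] are mirror-image convex combinations of [x] and [y + h], so the
   two convexity inequalities add up to the claim. *)
pose l := h / (y - x + h).
have l01 : 0 <= l <= 1.
  by rewrite divr_ge0 ?(ltW s0')//= ler_pdivrMr// mul1r; lra.
have l01' : 0 <= 1 - l <= 1 by lra.
have := g_convex x (y + h) l01; have := g_convex x (y + h) l01'.
rewrite (_ : (1 - l) * x + l * (y + h) = x + h); last by rewrite /l; field.
rewrite (_ : (1 - (1 - l)) * x + (1 - l) * (y + h) = y); last by rewrite /l; field.
lra.
Qed.

(** A slope bound read off the chord of the convex [g] from [u] to [B + 1]; ending at [B + 1] rather
    than [B] keeps its length at least 1. *)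
Let g_lipschitz (B u v : R) : - B <= u -> u <= v -> v <= B ->
  g v - g u <= g (B + 1) * (v - u).
Proof.
move=> Bu uv vB.
pose l := (v - u) / (B + 1 - u); have s0 : 0 < B + 1 - u by lra.
have l01 : 0 <= l <= 1.
  rewrite ler_pdivlMr// mul0r ler_pdivrMr// mul1r; lra.
have := g_convex u (B + 1) l01.
rewrite (_ : (1 - l) * u + l * (B + 1) = v); last by rewrite /l; field; rewrite gt_eqF.
have gu : 0 <= g u by exact: powR_ge0.
have gB : 0 <= g (B + 1) by exact: powR_ge0.
have lvu : l <= v - u by rewrite /l ler_pdivrMr// ler_peMr ?subr_ge0//; lra.
have h1 : l * g u >= 0 by rewrite mulr_ge0//; lra.
have h2 : l * g (B + 1) <= (v - u) * g (B + 1) by rewrite ler_wpM2r.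
lra.
Qed.

Let g_even x : g (- x) = g x. Proof. by rewrite /g normrN. Qed.

Let i0 : 'I_2 := ord0.
Let i1 : 'I_2 := ord_max.

(* Adding the linear term, whose mean does not depend on the coupling, makes
   the cost monotone. *)
Definition lin_cost (B : R) (u : 'I_2 -> R) : R :=
  g (2 * B + 1) * (u i0 + u i1) - g (u i0 - u i1).

Let ord2 (i : 'I_2) : (i == i0) || (i == i1).
Proof. by case: i => -[|[|]]. Qed.

Lemma lin_cost_mono B : box_mono (fun=> `[- B, B]%classic) (lin_cost B).
Proof.
apply: coordinatewise_mono => u i a Ju; rewrite /= in_itv/= => /andP[Ba aB] ua.
have := Ju i0; have := Ju i1; rewrite /= !in_itv/= => /andP[u1 u1'] /andP[u0 u0'].
case/orP: (ord2 i) => /eqP ii; rewrite ii /lin_cost /update/= in ua *.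
(* Differences of coordinates lie in [-2B, 2B], so [g_lipschitz] with [2 * B] yields exactly the
   constant of [lin_cost]; evenness of [g] covers the other coordinate. *)
- have : g (a - u i1) - g (u i0 - u i1) <= g (2 * B + 1) * (a - u i1 - (u i0 - u i1)).
    by apply: g_lipschitz; lra.
  lra.
- have : g (a - u i0) - g (u i1 - u i0) <= g (2 * B + 1) * (a - u i0 - (u i1 - u i0)).
    by apply: g_lipschitz; lra.
  rewrite -(g_even (u i0 - a)) -(g_even (u i0 - u i1)) !opprB; lra.
Qed.

(** The linear term has zero second difference, and convexity of [g] makes -g(x - y)
    supermodular. *)
Lemma lin_cost_id B : increasing_differences (fun=> `[- B, B]%classic) (lin_cost B).
Proof.
apply: pairwise_increasing_differences => i j u a a' c c' ij _ _ _ aa' _ _ cc'.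
have key x x' y y' : x <= x' -> y <= y' ->
    g (x' - y') + g (x - y) <= g (x' - y) + g (x - y').
  move=> xx' yy'; have := @g_increments (x - y') (x - y) (x' - x).
  rewrite (_ : x - y' + (x' - x) = x' - y'); last by ring.
  rewrite (_ : x - y + (x' - x) = x' - y); last by ring.
  rewrite (addrC (g (x' - y))); apply; lra.
case/orP: (ord2 i) => /eqP ii; case/orP: (ord2 j) => /eqP jj;
  rewrite ii jj ?eqxx // in ij *; rewrite /lin_cost /update/=.
- have := key _ _ _ _ aa' cc'; lra.
- have := key _ _ _ _ cc' aa'; lra.
Qed.

End power_cost.

Section signed_law_theory.
Context {R : realType}.
Variable s : R.
Hypothesis ss : s * s = 1.

Lemma sign_norm : `|s| = 1.
Proof.
have : `|s| * `|s| = 1 by rewrite -normrM ss normr1.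
move=> /eqP; rewrite -expr2 sqrp_eq1 ?normr_ge0// => /eqP.
exact.
Qed.

Lemma measurable_scale :
  measurable_fun setT (fun x : measurableTypeR R => s * x : measurableTypeR R).
Proof. exact: mulrl_measurable. Qed.

Definition signed_law (mu : probability (measurableTypeR R) R) := law mu measurable_scale.

(** For [s = -1], the map [s * signed_quantile mu] runs through [mu] from the top down, as a
    decreasing variable of b requires. *)
Definition signed_quantile mu := real_quantile (signed_law mu).

Variables (mu : probability (measurableTypeR R) R) (B : R).
Hypothesis muB : mu `[- B, B]%classic = 1%E.

Lemma signed_law_bounded : signed_law mu `[- B, B]%classic = 1%E.
Proof.
rewrite lawE -muB; congr (mu _); apply/seteqP; split => x /=;
  by rewrite !in_itv/= -!ler_norml normrM sign_norm mul1r.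
Qed.

Lemma signed_quantile_law A : measurable A ->
  unif ((fun m => s * signed_quantile mu m) @^-1` A) = mu A.
Proof.
move=> mA; have mA' : measurable
      ((fun x : measurableTypeR R => s * x : measurableTypeR R) @^-1` A).
  by rewrite -[X in measurable X]setTI; exact: measurable_scale.
rewrite -[LHS]/(unif (signed_quantile mu @^-1`
  ((fun x : measurableTypeR R => s * x) @^-1` A))).
rewrite (real_quantile_law signed_law_bounded)// lawE; congr (mu _).
by apply/seteqP; split => x /=; rewrite mulrA ss mul1r.
Qed.

End signed_law_theory.

Section wasserstein.
Context {R : realType}.
Variables (s p B : R) (mu nu : probability (measurableTypeR R) R).
Hypotheses (ss : s * s = 1) (p1 : 1 <= p) (B0 : 0 <= B).
Hypotheses (muB : mu `[- B, B]%classic = 1%E) (nuB : nu `[- B, B]%classic = 1%E).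

Let W := signed_quantile s mu.
Let W' := signed_quantile s nu.

Let bW : bm W. Proof. exact: (real_quantile_bm (signed_law_bounded ss muB) B0). Qed.
Let bW' : bm W'. Proof. exact: (real_quantile_bm (signed_law_bounded ss nuB) B0). Qed.
Lemma bm_powR_norm d0 (T : measurableType d0) (f : T -> R) :
  bm f -> bm (fun x => `|f x| `^ p).
Proof.
move=> [mf [C fC]]; split.
  apply: (measurableT_comp (measurable_powR p)); exact: measurableT_comp.
exists (`|C| `^ p) => x; rewrite ger0_norm ?powR_ge0//.
apply: ge0_ler_powR; rewrite ?nnegrE// ?(le_trans _ p1)//.
by apply: le_trans (fC x) _; exact: ler_norm.
Qed.

(** A coupling charges [-B, B]^2 only up to a null set, while [bm] asks for bounds everywhere.
    Clamping is 1-Lipschitz, so it can only lower the cost. *)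
Let clamp (x : R) : R := Num.max (- B) (Num.min x B).

Let clamp_id x : `|x| <= B -> clamp x = x.
Proof. by rewrite ler_norml => /andP[? ?]; rewrite /clamp min_l// max_r. Qed.

Let clamp_bound x : - B <= clamp x <= B.
Proof.
rewrite /clamp le_max lexx/= ge_max ge_min lexx orbT andbT.
by rewrite (le_trans _ B0)// oppr_le0.
Qed.

Let clamp_lip x y : `|clamp x - clamp y| <= `|x - y|.
Proof.
have B0' := B0.
have mono u v : u <= v -> 0 <= clamp v - clamp u <= v - u.
  move=> uv; rewrite /clamp; case: (leP u B) => uB; case: (leP v B) => vB;
    case: (leP (- B) u) => Bu; case: (leP (- B) v) => Bv;
    case: (leP (- B) B) => BB; lra.
have [xy|/ltW yx] := leP x y.
  have /andP[h1 h2] := mono _ _ xy.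
  by rewrite distrC (distrC x) !ger0_norm// subr_ge0.
have /andP[h1 h2] := mono _ _ yx.
by rewrite !ger0_norm// subr_ge0.
Qed.

Let mclamp : measurable_fun setT clamp.
Proof.
by apply: measurable_maxr => //; apply: measurable_minr.
Qed.

Lemma quantile_cost_le pi : couplings2 mu nu pi ->
  ((E unif (fun m => `|(W m : R) - W' m| `^ p))%:E <=
   \int[pi]_z (`|(z.1 : R) - (z.2 : R)| `^ p)%:E)%E.
Proof.
move=> cpi.
pose X (i : 'I_2) (z : measurableTypeR R * measurableTypeR R) : R :=
  s * (if i == ord0 then z.1 else z.2).
pose Y i z := clamp (X i z).
pose rho (i : 'I_2) := signed_law s (if i == ord0 then mu else nu).
have rB i : rho i `[- B, B]%classic = 1%E.
  by apply: signed_law_bounded => //; case: (i == ord0).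
pose V i := real_quantile (rho i).
have mX i : measurable_fun setT (X i).
  by rewrite /X; case: (i == ord0); apply: measurable_funM.
have bY i : bm (Y i).
  split; first exact: (measurableT_comp mclamp (mX i)).
  by exists B => z; rewrite ler_norml clamp_bound.
have bV i : bm (V i) by exact: (real_quantile_bm (rB i)).
have VB i m : `|V i m| <= B by exact: (real_quantile_bound (rB i)).
have lawX i (A : set (measurableTypeR R)) : measurable A -> pi (X i @^-1` A) = rho i A.
  move=> mA; have mA' : measurable
      ((fun x : measurableTypeR R => s * x : measurableTypeR R) @^-1` A).
    by rewrite -[X in measurable X]setTI; exact: measurable_scale.
  have [c1 c2] := cpi _ mA'.
  by rewrite /rho /X lawE; case: (i == ord0); rewrite -?c1 -?c2.
have EYV i : E pi (Y i) = E unif (V i).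
  have -> : V i = clamp \o V i by apply/funext => m /=; rewrite clamp_id.
  have bc : @bm R _ (measurableTypeR R) clamp.
    by split => //; exists B => x; rewrite ler_norml clamp_bound.
  apply: (@E_same_law _ _ _ _ _ _ (measurableTypeR R) pi unif (X i) (V i) clamp) => //.
  - exact: mX.
  - exact: (bV i).1.
  - by move=> A mA; rewrite lawX// (real_quantile_law (rB i)).
pose D := [set z | forall i, (X i @^-1` `[- B, B]%classic) z].
have [mD PD] : measurable D /\ pi D = 1%E.
  apply: prob_forall => i; last by rewrite [LHS]lawX.
  by rewrite -[X in measurable X]setTI; exact: mX.
pose L : R := `|2 * B + 1| `^ p.
pose Z z : R := L * (Y ord0 z + Y ord_max z) - `|Y ord0 z - Y ord_max z| `^ p.
pose h m : R := L * (V ord0 m + V ord_max m) - `|V ord0 m - V ord_max m| `^ p.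
have bcZ : bm (fun z => `|Y ord0 z - Y ord_max z| `^ p) by exact/bm_powR_norm/bmB.
have bch : bm (fun m => `|V ord0 m - V ord_max m| `^ p) by exact/bm_powR_norm/bmB.
have bZ : bm Z by apply: bmB => //; apply: bmZ; exact: bmD.
have bh : bm h by apply: bmB => //; apply: bmZ; exact: bmD.
(* [Z] and [h] are [lin_cost] along the clamped coordinates and along the quantiles. *)
have opt : E pi Z <= E unif h.
  apply: (@mean_opt R 2 (fun=> `[- B, B]%classic) (lin_cost p B) _ _ V _ _ h bh
    (fun _ _ => erefl) _ _ pi X D Z) => //.
  - exact: lin_cost_mono.
  - exact: lin_cost_id.
  - by move=> i m _ /=; rewrite in_itv/= -ler_norml.
  - by move=> i m m'; exact: (real_quantile_nd (rB i)).
  - move=> i t t01; have := real_quantile_tail (rB i) t01.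
    by rewrite -lawX// preimage_itvoy.
  - move=> z Dz; have zB i : clamp (X i z) = X i z.
      by apply: clamp_id; have := Dz i; rewrite /= in_itv/= -ler_norml.
    by rewrite /Z /Y !zB.
have EZ1 : E pi Z = L * (E unif (V ord0) + E unif (V ord_max)) -
    E pi (fun z => `|Y ord0 z - Y ord_max z| `^ p).
  have b0 := bmD (bY ord0) (bY ord_max).
  by rewrite (EB pi (bmZ L b0) bcZ) (EZ pi L b0) (ED pi (bY ord0) (bY ord_max)) !EYV.
have Eh1 : E unif h = L * (E unif (V ord0) + E unif (V ord_max)) -
    E unif (fun m => `|V ord0 m - V ord_max m| `^ p).
  have b0 := bmD (bV ord0) (bV ord_max).
  by rewrite (EB unif (bmZ L b0) bch) (EZ unif L b0) (ED unif (bV ord0) (bV ord_max)).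
(* The linear parts have equal means by [EYV]; they cancel and the inequality is reversed for the
   cost. *)
have {}opt : E unif (fun m => `|V ord0 m - V ord_max m| `^ p) <=
   E pi (fun z => `|Y ord0 z - Y ord_max z| `^ p) by move: opt; rewrite EZ1 Eh1; lra.
apply: (@le_trans _ _ (E pi (fun z => `|Y ord0 z - Y ord_max z| `^ p))%:E).
  by rewrite lee_fin; exact: opt.
rewrite /E /Rintegral fineK; last first.
  by apply: integrable_fin_num => //; exact: (bm_integrable _ _ bcZ).
apply: ge0_le_integral => //.
- apply/measurable_EFinP; exact: bcZ.1.
- apply/measurable_EFinP; apply: (measurableT_comp (measurable_powR p)).
  by apply: measurableT_comp => //; apply: measurable_funB.
- move=> z _; rewrite lee_fin; apply: ge0_ler_powR; rewrite ?nnegrE// ?(le_trans _ p1)//.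
  apply: le_trans (clamp_lip _ _) _.
  by rewrite /X/= -mulrBr normrM (sign_norm ss) mul1r.
Qed.

(** A common change of sign preserves |x - y|, so the formula holds for either [s], which allows the
    orientation of each coordinate. The infimum is attained at the joint law of [s * W] and
    [s * W']. *)
Lemma Wasserstein_quantile :
  Wasserstein p mu nu = (((E unif (fun m => `|(W m : R) - W' m| `^ p)) `^ p^-1)%:E)%E.
Proof.
rewrite /Wasserstein -poweR_EFin; congr (_ `^ _)%E.
apply/eqP; rewrite eq_le; apply/andP; split; last first.
  by apply: le_ereal_inf_tmp => _ [pi cpi <-]; exact: quantile_cost_le.
have mW (V : measurableTypeR R -> R) : bm V ->
    measurable_fun setT (fun m => s * V m : measurableTypeR R).
  by move=> bV; exact: (bmZ s bV).1.
have mG := measurable_fun_pair (mW _ bW) (mW _ bW').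
pose c (z : measurableTypeR R * measurableTypeR R) := (`|(z.1 : R) - (z.2 : R)| `^ p)%:E.
have mc : measurable_fun setT c.
  apply/measurable_EFinP; apply: (measurableT_comp (measurable_powR p)).
  by apply: measurableT_comp => //; apply: measurable_funB.
apply: ereal_inf_lbound; exists (law unif mG).
  move=> A mA; split; rewrite /pushforward lawE -[X in X = _]/(unif ((fun m => s * _ m) @^-1` A)).
    exact: (signed_quantile_law ss muB).
  exact: (signed_quantile_law ss nuB).
rewrite [LHS](ge0_integral_pushforward mG)//.
rewrite preimage_setT /E /Rintegral fineK; last first.
  apply: integrable_fin_num => //; apply: (bm_integrable _ _ (bm_powR_norm _)) => //.
  exact: bmB.
by apply: eq_integral => m _ /=; rewrite -mulrBr normrM (sign_norm ss) mul1r.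
Qed.

End wasserstein.

(** * Second differences and mixed partial derivatives *)

Section partial_derivatives.
Context {R : realType} {d : nat}.
Variable I : 'I_d -> set R.
Hypothesis iI : forall i, is_interval (I i).
Implicit Types (F : 'rV[R]_d -> R) (w : 'I_d -> R) (i j : 'I_d).

Definition pt w : 'rV[R]_d := \row_i w i.

Lemma ptE w i : pt w ord0 i = w i.
Proof. by rewrite mxE. Qed.

Lemma pt_box w : in_box I w -> box I (pt w).
Proof. by move=> Iw i; rewrite ptE. Qed.

Lemma pt_update_shift w j t h :
  pt (update w j t) + h *: delta_mx ord0 j = pt (update w j (t + h)).
Proof.
apply/rowP => i; rewrite !mxE /update eqxx /=.
by case: (i == j); rewrite ?mulr1// mulr0 addr0.
Qed.

Lemma pt_update_continuous w j : continuous (fun t : R => pt (update w j t)).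
Proof.
move=> t A /nbhs_ballP[e /= e0 eA].
apply/nbhs_ballP; exists e => //= s ts; apply: eA; split => // i k.
by rewrite !mxE /update; case: ifP => _ //; exact: ballxx.
Qed.

Lemma slice_continuous F w j c c' : {within box I, continuous F} ->
  in_box I w -> I j c -> I j c' ->
  {within `[c, c'], continuous (fun t => F (pt (update w j t)))}.
Proof.
move=> cF Iw Ic Ic'; apply/subspace_continuousP => t tc.
have Ibox s : `[c, c']%classic s -> box I (pt (update w j s)).
  move=> /= scc; apply: pt_box; apply: in_box_update => //; apply: (iI Ic Ic').
  by move: scc; rewrite in_itv.
have /subspace_continuousP/(_ _ (Ibox _ tc)) := cF.
apply: cvg_trans => A; rewrite /= !nbhs_simpl/= => FA.
have := @pt_update_continuous w j t _ FA.
rewrite !nbhs_simpl /within/= => h; near=> s => sc.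
by apply: (near h s) => //; exact: Ibox.
Unshelve. all: by end_near. Qed.

(** At an interior point all small increments are admissible: the filter is the full punctured
    neighbourhood, hence nondegenerate, and [pderiv] is the ordinary derivative of the slice. *)
Lemma slice_is_derive F w j c c' t : in_box I w -> I j c -> I j c' ->
  c < t < c' -> pderivable (box I) j F (pt (update w j t)) ->
  is_derive t 1 (fun s => F (pt (update w j s)))
    (pderiv (box I) j F (pt (update w j t))).
Proof.
move=> Iw Ic Ic' /andP[ct tc'].
have near_box : \forall h \near (0 : R)^',
    box I (pt (update w j t) + h *: delta_mx ord0 j).
  have h0 : 0 \in `](c - t), (c' - t)[ by rewrite in_itv/= subr_lt0 ct subr_gt0.
  apply: nbhs_dnbhs; apply: filterS (near_in_itvoo h0) => h.
  rewrite in_itv/= => /andP[ch hc'].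
  rewrite pt_update_shift; apply: pt_box; apply: in_box_update => //.
  by apply: (iI Ic Ic'); lra.
have incE : increments (box I) j (pt (update w j t)) = (0 : R)^'.
  apply/seteqP; split => A; rewrite /increments /within/=; last first.
    by apply: filterS.
  by move=> hA; apply: filterS2 near_box hA => h /[swap] /[apply].
have qE : diff_quotient F j (pt (update w j t)) =
    (fun h => h^-1 *: (((fun s => F (pt (update w j s))) \o shift t) (h *: (1 : R)) -
       F (pt (update w j t)))).
  by apply/funext => h; rewrite /diff_quotient pt_update_shift (addrC t h) /= [h *: (1 : R)]mulr1.
rewrite /pderivable /pderiv incE qE => dF; split => //.
rewrite asboolF //; exact: filter_not_empty.
Qed.

Lemma slice_mvt F w j c c' : {within box I, continuous F} ->
  (forall x, box I x -> pderivable (box I) j F x) ->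
  in_box I w -> I j c -> I j c' -> c <= c' ->
  exists2 t, I j t & F (pt (update w j c')) - F (pt (update w j c)) =
    pderiv (box I) j F (pt (update w j t)) * (c' - c).
Proof.
move=> cF dF Iw Ic Ic'; rewrite le_eqVlt => /predU1P[<-|cc'].
  by exists c => //; rewrite !subrr mulr0.
have dslice t : t \in `]c, c'[ -> is_derive t 1 (fun t => F (pt (update w j t)))
    (pderiv (box I) j F (pt (update w j t))).
  rewrite in_itv/= => tc; apply: (slice_is_derive Iw Ic Ic' tc).
  apply: dF; apply: pt_box; apply: in_box_update => //.
  by apply: (iI Ic Ic'); move: tc => /andP[/ltW -> /ltW].
have [t tcc' ->] := MVT cc' dslice (slice_continuous cF Iw Ic Ic').
exists t => //; apply: (iI Ic Ic').
by move: tcc'; rewrite in_itv/= => /andP[/ltW -> /ltW].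
Qed.

(** The mean value theorem in x_j for the difference of two slices of [F], then in x_i for its j-th
    partial derivative. This order yields [pderiv2] with indices [i j] directly, without symmetry of
    second derivatives. *)
Lemma second_difference F w i j a a' c c' : C2_on (box I) F -> i != j ->
  in_box I w -> I i a -> I i a' -> a <= a' -> I j c -> I j c' -> c <= c' ->
  exists2 x, box I x &
    F (pt (update (update w j c') i a')) - F (pt (update (update w j c') i a))
    - (F (pt (update (update w j c) i a')) - F (pt (update (update w j c) i a))) =
    pderiv2 (box I) i j F x * (a' - a) * (c' - c).
Proof.
move=> [[cF dF] C1F] ij Iw Ia Ia' aa' Ic Ic'; rewrite le_eqVlt => /predU1P[<-|cc'].
  by exists (pt w); [exact: pt_box | rewrite !subrr mulr0].
have ji : j != i by rewrite eq_sym.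
pose g e t := F (pt (update (update w i e) j t)).
pose dg e t := pderiv (box I) j F (pt (update (update w i e) j t)).
have gE e t : F (pt (update (update w j t) i e)) = g e t by rewrite update_comm.
have dgE e t : pderiv (box I) j F (pt (update (update w j t) i e)) = dg e t by rewrite update_comm.
have Iwe e : I i e -> in_box I (update w i e) by exact: in_box_update.
have Icc t : c < t < c' -> I j t.
  by move=> /andP[/ltW ct /ltW tc]; apply: (iI Ic Ic'); rewrite ct.
have gd e t : I i e -> c < t < c' -> is_derive t 1 (g e) (dg e t).
  move=> Ie tc; apply: (slice_is_derive (Iwe _ Ie) Ic Ic' tc).
  by apply: (dF j).1; apply: pt_box; apply: in_box_update; [exact: Iwe | exact: Icc].
have gc e : I i e -> {within `[c, c'], continuous (g e)}.
  by move=> Ie; exact: (slice_continuous cF (Iwe _ Ie) Ic Ic').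
rewrite !gE.
have dd t : t \in `]c, c'[ -> is_derive t 1 (g a' - g a) (dg a' t - dg a t).
  by rewrite in_itv/= => tc; apply: is_deriveB; exact: gd.
have cd : {within `[c, c'], continuous (g a' - g a)}.
  by move=> t; apply: (@cvgB _ R); [exact: (gc _ Ia') | exact: (gc _ Ia)].
have [t] := MVT cc' dd cd; rewrite in_itv/= => tc ->; rewrite -!dgE.
have [cG dG] := C1F j.
have [e Ie ->] := slice_mvt cG (fun x => (dG i).1 x) (in_box_update Iw (Icc _ tc)) Ia Ia' aa'.
by exists (pt (update (update w j t) i e)) => //; apply: pt_box; apply: in_box_update => //;
  apply: in_box_update => //; exact: Icc.
Qed.

End partial_derivatives.

(** * Borel sets of row vectors *)

Section borel_row_vectors.
Context {R : realType} {d : nat}.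
Local Notation T := (borel_rV R d).

Lemma borel_rV_open (A : set 'rV[R]_d) : open A -> measurable (A : set T).
Proof. by move=> oA; exact: sub_sigma_algebra. Qed.

Lemma borel_rV_coord (i : 'I_d) : measurable_fun setT (fun x : T => x ord0 i : R).
Proof.
move=> _; apply: (measurability _ (RGenOpens.measurableE R)) => //.
move=> /= _ [_ [a [c ->]] <-]; rewrite setTI; apply: borel_rV_open.
have /continuousP := @coord_continuous R 1 d ord0 i; apply.
exact: interval_open.
Qed.

Lemma borel_rV_box (I : 'I_d -> set R) : (forall i, is_interval (I i)) ->
  measurable (box I : set T).
Proof.
move=> iI.
have -> : (box I : set T) = \bigcap_(i in [set: 'I_d]) ((fun x : T => x ord0 i) @^-1` I i).
  by apply/seteqP; split => [x h i _|x h i]; [exact: h | exact: (h i Logic.I)].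
apply: fin_bigcap_measurable => [|i _]; first exact: finite_finset.
rewrite -[X in measurable X]setTI; apply: borel_rV_coord => //.
exact: is_interval_measurable.
Qed.

Lemma within_continuous_borel (X : set 'rV[R]_d) (b : 'rV[R]_d -> R) :
  measurable (X : set T) -> {within X, continuous b} ->
  measurable_fun setT (b \_ X : T -> R).
Proof.
move=> mX cb; apply/(measurable_restrictT _ _).1 => //.
move=> _; apply: (measurability _ (RGenOpens.measurableE R)) => //.
move=> /= _ [_ [a [c ->]] <-].
have /continuousP/(_ _ (@interval_open _ (BRight a) (BLeft c) isT isT))/open_subspaceP := cb.
move=> [V oV VX]; rewrite setIC -VX.
by apply: measurableI => //; exact: borel_rV_open.
Qed.

(** An open set of row vectors is a countable union of cubes with rational centre and radius, and
    the preimage of a cube is a finite intersection of coordinate events. *)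
Lemma measurable_row d0 (S : measurableType d0) (G : 'I_d -> S -> R) :
  (forall i, measurable_fun setT (G i)) ->
  measurable_fun setT (fun s => pt (G ^~ s) : T).
Proof.
move=> mG _.
have mE : (measurable : set (set T)) = <<s @open 'rV[R]_d >> by [].
apply: (measurability _ mE) => //.
move=> _ [V oV <-]; rewrite setTI.
pose ctr (q : 'rV[rat]_d * rat) : 'rV[R]_d := map_mx ratr q.1.
pose bx q : set 'rV[R]_d := [set y | forall i, ball (ctr q ord0 i) (ratr q.2) (y ord0 i)].
pose Q := [set q | bx q `<=` V].
have -> : (fun s => pt (G ^~ s)) @^-1` V =
    \bigcup_(q : 'rV[rat]_d * rat) (if pselect (Q q) then
      \bigcap_(i in [set: 'I_d]) (G i @^-1` ball (ctr q ord0 i) (ratr q.2)) else set0).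
  apply/seteqP; split => [s /= Os|s [q _]]; last first.
    case: pselect => //= Qq h; apply: Qq => i; rewrite ptE; exact: h.
  have [e /= e0 eO] := (nbhs_ballP _ _).1 (open_nbhs_nbhs (conj oV Os)).
  (* With radius below [e / 2] and a centre within the radius of the point, the cube contains the
     point and stays within [e] of it. *)
  have [r] := rat_in_itvoo (divr_gt0 e0 (ltr0n R 2)).
  rewrite in_itv/= => /andP[r0 re].
  have near_rat i : exists q : rat, ball (ratr q : R) (ratr r) (G i s).
    have lt : G i s - ratr r < G i s by rewrite ltrBlDr ltrDl.
    have [q] := rat_in_itvoo lt.
    rewrite in_itv/= => /andP[h1 h2]; exists q.
    by rewrite /ball/= ltr_norml; apply/andP; split; lra.
  have [ctr_q hctr] := choice near_rat.
  pose q := (\row_i ctr_q i : 'rV[rat]_d, r).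
  exists q => //; case: pselect => [_ i _ /=|]; first by rewrite /ctr !mxE.
  case=> y /= hy; apply: eO; split => // j i; rewrite ord1.
  have := hy i; have := hctr i; rewrite /ctr !mxE /ball/= => h1 h2.
  apply: (@le_lt_trans _ _ (`|ratr (ctr_q i) - G i s| + `|ratr (ctr_q i) - y ord0 i|)).
    rewrite -(normrN (ratr (ctr_q i) - G i s)).
    rewrite (_ : G i s - y ord0 i = - (ratr (ctr_q i) - G i s) + (ratr (ctr_q i) - y ord0 i)).
      exact: ler_normD.
    by ring.
  lra.
apply: countable_bigcupT_measurable; first exact: countableP.
move=> q; case: (pselect (Q q)) => Qq; last exact: measurable0.
apply: fin_bigcap_measurable => [|i _]; first exact: finite_finset.
rewrite -[X in measurable X]setTI; apply: mG => //.
by apply: open_measurable; exact: ball_open.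
Qed.

End borel_row_vectors.

(** * Risk as an expectation, and Jensen's inequality for roots *)

Lemma integral_unif {R : realType} (g : measurableTypeR R -> R) : bm g ->
  (\int[lebesgue_measure]_(m in `[0%R, 1%R]) (g m)%:E)%E = (E unif g)%:E.
Proof.
move=> bg; have mg : measurable_fun setT (EFin \o g).
  by apply/measurable_EFinP; exact: bg.1.
rewrite /E /Rintegral fineK; last first.
  by apply: integrable_fin_num => //; exact: (bm_integrable _ _ bg).
rewrite [LHS]integralE [RHS]integralE /= !integral_uniform//.
- by rewrite subr0 invr1 !mul1e.
- exact: measurable_funeneg.
- exact: measurable_funepos.
Qed.

(** The endpoints are discarded first: at 0 the extended quantile is -oo, and only inside []0, 1[]
    are the two quantiles identified. *)
Lemma spectral_risk_real_quantile {R : realType} (rho : probability (measurableTypeR R) R)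
  (B : R) (alpha a : R -> R) : rho `[- B, B]%classic = 1%E -> 0 <= B ->
  (forall m, 0 < m < 1 -> a m = alpha m) -> @bm R _ (measurableTypeR R) a ->
  spectral_risk alpha rho = (E unif (fun m => real_quantile rho m * a m))%:E.
Proof.
move=> rB B0 aE ba.
have bqa : bm (fun m : measurableTypeR R => real_quantile rho m * a m).
  by apply: bmM => //; exact: (real_quantile_bm rB).
have qE m : m \in `]0, 1[ ->
    (quantile rho m * (alpha m)%:E)%E = (real_quantile rho m * a m)%:E.
  rewrite in_itv/= => m01; rewrite EFinM aE//; congr (_ * _)%E.
  exact: (real_quantileE rB).
have mqa : measurable_fun (`]0, 1[%classic : set (measurableTypeR R))
    (fun m => (real_quantile rho m * a m)%:E).
  by apply/measurable_EFinP; apply: measurable_funTS; exact: bqa.1.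
rewrite /spectral_risk -integral_unif//.
rewrite integral_itv_bndoo; last first.
  by apply: eq_measurable_fun mqa => m; rewrite inE => /qE.
rewrite [RHS]integral_itv_bndoo//.
by apply: eq_integral => m; rewrite inE => /qE.
Qed.

(** Young's inequality c^(p-1) S^(1/p) <= S/p + c^p/q is the tangent line of the concave root; its
    expectation suffices once E S <= c^p. The case p = 1, with no finite conjugate exponent, is
    separate. *)
Lemma jensen_root {R : realType} d0 (T : measurableType d0) (P : probability T R)
  (S : T -> R) (p : R) : 1 <= p -> bm S -> (forall x, 0 <= S x) ->
  bm (fun x => S x `^ p^-1) /\ E P (fun x => S x `^ p^-1) <= E P S `^ p^-1.
Proof.
move=> p1 bS S0; have p0 : 0 < p by exact: lt_le_trans p1.
have bN : bm (fun x => S x `^ p^-1).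
  split; first exact: (measurableT_comp (measurable_powR p^-1) bS.1).
  have [C SC] := bS.2; exists (`|C| `^ p^-1) => x; rewrite ger0_norm ?powR_ge0//.
  apply: ge0_ler_powR; rewrite ?nnegrE ?invr_ge0 ?(ltW p0)//.
  by apply: le_trans (ler_norm _) (le_trans (SC x) (ler_norm _)).
split => //; have ES0 : 0 <= E P S by exact: E_ge0.
have [pE|pn] := eqVneq p 1.
  rewrite pE invr1 powRr1//; apply: E_leT => //.
    by move: bN; rewrite pE invr1.
  by move=> x; rewrite powRr1.
have p1' : 1 < p by rewrite lt_neqAle eq_sym pn.
(* The root of the mean may be 0, so [c] exceeds it by [e] to allow division by c^(p-1). *)
apply/ler_addgt0Pr => e e0; set A := E P S `^ p^-1; pose c := A + e.
have A0 : 0 <= A by exact: powR_ge0.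
have c0 : 0 < c by rewrite ltr_wpDl.
have cp0 : 0 < c `^ (p - 1) by rewrite powR_gt0.
pose q := p / (p - 1).
have q0 : 0 < q by rewrite divr_gt0// subr_gt0.
have pq : p^-1 + q^-1 = 1.
  by rewrite /q invf_div; field; rewrite gt_eqF.
have Sc : E P S <= c `^ p.
  have -> : E P S = A `^ p by rewrite /A -powRrM mulVf ?gt_eqF// powRr1.
  by apply: ge0_ler_powR; rewrite ?nnegrE ?(ltW p0) ?(ltW c0)// lerDl ltW.
have young x : c `^ (p - 1) * S x `^ p^-1 <= p^-1 * S x + q^-1 * c `^ p.
  have := conjugate_powR (powR_ge0 (S x) p^-1) (ltW cp0) p0 q0 pq.
  rewrite -!powRrM mulVf ?gt_eqF// powRr1//.
  rewrite (_ : (p - 1) * q = p); last by rewrite /q mulrCA divff ?mulr1// subr_eq0.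
  by rewrite mulrC (mulrC (S x)) (mulrC (c `^ p)).
have : c `^ (p - 1) * E P (fun x => S x `^ p^-1) <= c `^ (p - 1) * c.
  rewrite -EZ//.
  apply: (@le_trans _ _ (E P (fun x => p^-1 * S x + q^-1 * c `^ p))).
    apply: E_leT => //; first exact: bmZ.
    by apply: bmD; [exact: bmZ | exact: bm_cst].
  rewrite ED ?E_cst ?EZ//; [|exact: bmZ|exact: bm_cst].
  have -> : c `^ (p - 1) * c = c `^ p.
    rewrite -[X in _ * X]powRr1 ?(ltW c0)// -powRD; last by rewrite (gt_eqF c0) implybT.
    by rewrite subrK.
  rewrite -[leRHS]mul1r -pq mulrDl lerD2r ler_wpM2l// invr_ge0 ltW//.
by rewrite ler_pM2l.
Qed.

(** * Maximal risk and its stability *)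

Section reoriented.
Context {R : realType} {d : nat}.
Variables (I : 'I_d -> set R) (b : 'rV[R]_d -> R) (Sp Sm : {set 'I_d}).
Hypothesis iI : forall i, is_interval (I i).
Hypothesis hb : weakly_compatible (box I) b.
Hypothesis hS : associated_partition (box I) b Sp Sm.
Hypothesis hinc : forall i, i \in Sp -> increasing_in (box I) i b.
Hypothesis hdec : forall i, i \in Sm -> decreasing_in (box I) i b.

Definition orient (i : 'I_d) : R := if i \in Sp then 1 else -1.

Lemma orientK i : orient i * orient i = 1.
Proof. by rewrite /orient; case: ifP => _; rewrite ?mulr1// mulrNN mulr1. Qed.

Definition flip (w : 'I_d -> R) : 'I_d -> R := fun i => orient i * w i.

Definition Jbox (i : 'I_d) : set R := [set v | I i (orient i * v)].

(* [b] in the coordinates where the variables in [S_-] change sign: there it is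
   increasing with increasing differences. *)
Definition reoriented (w : 'I_d -> R) : R := b (pt (flip w)).

Lemma flip_box w : in_box Jbox w -> in_box I (flip w).
Proof. by move=> Jw i; exact: Jw. Qed.

Lemma flip_update w i a : flip (update w i a) = update (flip w) i (orient i * a).
Proof.
by apply/funext => j; rewrite /flip /update; case: (eqVneq j i) => [->|].
Qed.

Lemma Jbox_interval i : is_interval (Jbox i).
Proof.
move=> x y Jx Jy z /andP[xz zy]; rewrite /Jbox /= in Jx Jy *.
rewrite /orient in Jx Jy *; case: ifP Jx Jy => _.
  by rewrite !mul1r => Jx Jy; apply: (iI Jx Jy); rewrite xz.
by rewrite !mulN1r => Jx Jy; apply: (iI Jy Jx); rewrite !lerN2 zy.
Qed.

Lemma notSp i : i \notin Sp -> i \in Sm.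
Proof.
have [/setP/(_ i) + _ _] := hS; rewrite !inE => /orP[->//|//].
Qed.

Lemma Sp_notSm i : i \in Sp -> i \notin Sm.
Proof.
have [_ /setP/(_ i) + _] := hS; rewrite !inE => h ip.
by move: h; rewrite ip/= => ->.
Qed.

Lemma reoriented_mono : box_mono Jbox reoriented.
Proof.
apply: coordinatewise_mono => u i a Ju Ja ua; rewrite /reoriented flip_update.
have Iu : box I (pt (flip u)) by apply: pt_box; exact: flip_box.
have Iua : box I (pt (update (flip u) i (orient i * a))).
  by apply: pt_box; apply: in_box_update => //; exact: flip_box.
have off j : j != i -> pt (flip u) ord0 j = pt (update (flip u) i (orient i * a)) ord0 j.
  by move=> ji; rewrite !ptE /update (negbTE ji).
have at_i : pt (update (flip u) i (orient i * a)) ord0 i = orient i * a.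
  by rewrite ptE /update eqxx.
have [ip|/[dup] ip /notSp im] := boolP (i \in Sp).
  apply: (hinc ip) => //; rewrite at_i ptE /flip /orient ip !mul1r//.
apply: (hdec im) => //; last by rewrite at_i ptE /flip /orient (negbTE ip) !mulN1r lerN2.
by move=> j ji; rewrite off.
Qed.

Lemma same_side i j :
  ((i \in Sp) && (j \in Sp)) || ((i \in Sm) && (j \in Sm)) = ((i \in Sp) == (j \in Sp)).
Proof.
have [ip|ip] := boolP (i \in Sp); have [jp|jp] := boolP (j \in Sp) => //=.
- by rewrite (negbTE (Sp_notSm ip)).
- by rewrite (negbTE (Sp_notSm jp)) andbF.
- by rewrite !notSp.
Qed.

(** Each reflection swaps the endpoints of one variable and reverses the sign of the second
    difference. Two variables on the same side undergo zero or two reversals, variables on opposite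
    sides exactly one, which matches the sign of their mixed derivative. *)
Lemma reoriented_id : increasing_differences Jbox reoriented.
Proof.
have [C2b _ _] := hb; have [_ _ hsign] := hS.
apply: pairwise_increasing_differences => i j u a a' c c' ij Ju Ja Ja' aa' Jc Jc' cc'.
have Iu := flip_box Ju.
have sd := @second_difference R d I iI b (flip u) i j _ _ _ _ C2b ij Iu.
rewrite /reoriented !flip_update.
rewrite /Jbox/= in Ja Ja' Jc Jc'.
have sgn x : box I x -> if (i \in Sp) == (j \in Sp) then 0 <= pderiv2 (box I) i j b x
    else pderiv2 (box I) i j b x <= 0.
  by move=> Ix; have := hsign _ _ ij _ Ix; rewrite same_side.
have daa : 0 <= a' - a by rewrite subr_ge0.
have dcc : 0 <= c' - c by rewrite subr_ge0.
have prod_ge0 (D : R) : 0 <= D -> 0 <= D * (a' - a) * (c' - c).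
  by move=> D0; rewrite !mulr_ge0.
move: Ja Ja' Jc Jc' sgn; rewrite /orient.
case: (i \in Sp); case: (j \in Sp); rewrite ?mul1r ?mulN1r => Ia Ia' Ic Ic' sgn.
- by have [x Ix ->] := sd _ _ _ _ Ia Ia' aa' Ic Ic' cc'; exact/prod_ge0/sgn.
- have [|x Ix xE] := sd _ _ _ _ Ia Ia' aa' Ic' Ic; first by rewrite lerN2.
  have := prod_ge0 (- pderiv2 (box I) i j b x); rewrite oppr_ge0 => /(_ (sgn _ Ix)).
  move: xE; lra.
- have [||x Ix xE] := sd _ _ _ _ Ia' Ia _ Ic Ic'; rewrite ?lerN2//.
  have := prod_ge0 (- pderiv2 (box I) i j b x); rewrite oppr_ge0 => /(_ (sgn _ Ix)).
  move: xE; lra.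
- have [||x Ix xE] := sd _ _ _ _ Ia' Ia _ Ic' Ic; rewrite ?lerN2//.
  have := prod_ge0 _ (sgn _ Ix); move: xE; lra.
Qed.

End reoriented.

Lemma bounded_box {R : realType} d (I : 'I_d -> set R) :
  (forall i, bounded_set (I i)) ->
  exists2 B : R, 0 <= B & forall i, I i `<=` `[- B, B]%classic.
Proof.
move=> bI; have h i : exists B : R, 0 <= B /\ forall x, I i x -> `|x| <= B.
  by have [B B0 IB] := pinfty_ex_gt0 (bI i); exists B; split; [exact: ltW | move=> x /IB].
have [C hC] := choice h.
exists (\sum_i C i) => [|i x /(hC i).2 xC]; first by apply: sumr_ge0 => i _; exact: (hC i).1.
rewrite /= in_itv/= -ler_norml; apply: le_trans xC _.
rewrite (bigD1 i)//= lerDl sumr_ge0// => j _; exact: (hC j).1.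
Qed.

(** The intervals may be open, so the bound comes from comparison with one point of the box rather
    than from compactness. On an empty box the extension by 0 is bounded by 0. *)
Lemma pnorm_lipschitz_bounded {R : realType} d (I : 'I_d -> set R) (b : 'rV[R]_d -> R)
  (p K B : R) : 1 <= p -> (forall i, I i `<=` `[- B, B]%classic) ->
  pnorm_lipschitz_on (box I) p K b -> exists C, forall x, `|(b \_ (box I)) x| <= C.
Proof.
move=> p1 IB bK; have p0 : 0 <= p by exact: le_trans p1.
have [[x0 Ix0]|nI] := pselect (exists x, box I x); last first.
  exists 0 => x; rewrite patchE memNset ?normr0// => Ix; apply: nI; by exists x.
exists (`|b x0| + `|K| * (\sum_(i < d) (2 * B) `^ p) `^ p^-1) => x.
rewrite patchE; case: ifPn => [|_]; last first.
  by rewrite normr0 addr_ge0// mulr_ge0// powR_ge0.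
rewrite inE => Ix.
rewrite -[b x](subrK (b x0)) addrC; apply: le_trans (ler_normD _ _) _.
rewrite lerD2l; apply: le_trans (bK _ _ Ix Ix0) _.
apply: (@le_trans _ _ (`|K| * pnorm p (x - x0))).
  by rewrite ler_wpM2r ?powR_ge0// ler_norm.
rewrite ler_wpM2l// /pnorm; apply: ge0_ler_powR.
- by rewrite invr_ge0.
- by rewrite nnegrE sumr_ge0// => i _; exact: powR_ge0.
- by rewrite nnegrE sumr_ge0// => i _; exact: powR_ge0.
apply: ler_sum => i _; have := IB i _ (Ix i); have := IB i _ (Ix0 i).
rewrite /= !in_itv/= => /andP[h1 h2] /andP[h3 h4].
apply: ge0_ler_powR; rewrite ?nnegrE//; first by lra.
by rewrite !mxE ler_norml; lra.
Qed.

Section comonotone.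
Context {R : realType} {d : nat}.
Variables (I : 'I_d -> set R) (b : 'rV[R]_d -> R) (Sp Sm : {set 'I_d}) (B : R).
Hypothesis iI : forall i, is_interval (I i).
Hypothesis IB : forall i, I i `<=` `[- B, B]%classic.
Hypothesis B0 : 0 <= B.
Hypothesis hb : weakly_compatible (box I) b.
Hypothesis hS : associated_partition (box I) b Sp Sm.
Hypothesis hinc : forall i, i \in Sp -> increasing_in (box I) i b.
Hypothesis hdec : forall i, i \in Sm -> decreasing_in (box I) i b.
Hypothesis bbnd : exists C, forall x, `|(b \_ (box I)) x| <= C.
Variable mu : 'I_d -> probability (measurableTypeR R) R.
Hypothesis hmu : forall i, mu i (I i) = 1%E.

Local Notation f := (reoriented b Sp).
Local Notation J := (Jbox I Sp).
Local Notation eps := (@orient R d Sp).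

Definition oriented_quantile (i : 'I_d) : R -> R := signed_quantile (eps i) (mu i).

(** The h of the overview. Outside []0, 1[] the junk quantiles may leave the box; using
    [b \_ (box I)] keeps the function measurable and bounded there. *)
Definition comonotone_image (m : R) : R :=
  (b \_ (box I)) (pt (flip Sp (oriented_quantile ^~ m))).

Let muB i : mu i `[- B, B]%classic = 1%E.
Proof.
apply/eqP; rewrite eq_le probability_le1//= -(hmu i) le_measure ?inE//.
exact: is_interval_measurable.
Qed.

Let sB i : signed_law (eps i) (mu i) `[- B, B]%classic = 1%E.
Proof. by apply: signed_law_bounded => //; exact: orientK. Qed.

Lemma oriented_quantile_box i m : 0 < m < 1 -> J i (oriented_quantile i m).
Proof.
apply: (real_quantile_in (sB i) B0); first exact: Jbox_interval.
rewrite lawE -(hmu i); congr (mu i _); apply/seteqP; split => x;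
  by rewrite /Jbox/= mulrA orientK mul1r.
Qed.

Lemma oriented_quantile_nd i m m' : 0 < m -> m <= m' -> m' < 1 ->
  oriented_quantile i m <= oriented_quantile i m'.
Proof. exact: (real_quantile_nd (sB i)). Qed.

Lemma oriented_quantile_bm i : @bm R _ (measurableTypeR R) (oriented_quantile i).
Proof. exact: (real_quantile_bm (sB i) B0). Qed.

Let mrow : measurable_fun setT
  ((fun m => pt (flip Sp (oriented_quantile ^~ m))) : measurableTypeR R -> borel_rV R d).
Proof.
apply: (@measurable_row R d _ (measurableTypeR R) (fun i m => eps i * oriented_quantile i m)) => i.
exact: (bmZ (eps i) (oriented_quantile_bm i)).1.
Qed.

Let mb : measurable_fun setT (b \_ (box I) : borel_rV R d -> measurableTypeR R).
Proof.
apply: within_continuous_borel; first exact: borel_rV_box.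
by have [[[]]] := hb.
Qed.

Let mh : measurable_fun setT (comonotone_image : measurableTypeR R -> measurableTypeR R).
Proof. exact: (measurableT_comp mb mrow). Qed.

Lemma comonotone_image_bm : @bm R _ (measurableTypeR R) comonotone_image.
Proof. by split; [exact: mh | have [C bC] := bbnd; exists C => m; exact: bC]. Qed.

Lemma comonotone_imageE m : 0 < m < 1 -> comonotone_image m = f (oriented_quantile ^~ m).
Proof.
move=> m01; rewrite /comonotone_image patchE mem_set//; apply: pt_box; apply: flip_box => i.
exact: oriented_quantile_box.
Qed.

Lemma comonotone_image_nd m m' : 0 < m -> m <= m' -> m' < 1 ->
  comonotone_image m <= comonotone_image m'.
Proof.
exact: (composite_nd (reoriented_mono hS hinc hdec) oriented_quantile_box
  oriented_quantile_nd comonotone_imageE).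
Qed.

Variables (alpha a : R -> R) (M : R).
Hypothesis aE : forall m, 0 < m < 1 -> a m = alpha m.
Hypothesis ba : @bm R _ (measurableTypeR R) a.
Hypothesis aM : forall m, 0 < m < 1 -> 0 <= a m <= M.
Hypothesis and_ : forall m m', 0 < m -> m <= m' -> m' < 1 -> a m <= a m'.

Let image_risk (gamma : probability (borel_rV R d) R) :
  spectral_risk alpha (image_law (box I) b gamma) =
  (E unif (fun m => real_quantile (law gamma mb) m * a m))%:E.
Proof.
have [C bC] := bbnd.
have C0 : 0 <= `|C| by [].
have bC' x : `|(b \_ (box I)) x| <= `|C|.
  by apply: le_trans (bC x) _; exact: ler_norm.
have rB := law_bounded gamma mb bC'.
exact: (spectral_risk_real_quantile rB C0 aE ba).
Qed.

Lemma comonotone_is_max :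
  is_max [set spectral_risk alpha (image_law (box I) b gamma)
         | gamma in couplings mu] (E unif (fun m => comonotone_image m * a m))%:E.
Proof.
split.
  exists (law unif mrow).
    move=> i A mA; rewrite /pushforward lawE.
    rewrite [X in unif X](_ : _ = (fun m => eps i * oriented_quantile i m) @^-1` A).
      by apply: (signed_quantile_law _ (muB i)) => //; exact: orientK.
    by apply/seteqP; split => m; rewrite /= ptE.
  rewrite image_risk; congr EFin.
  exact: (spectral_attained mh comonotone_image_bm ba comonotone_image_nd aM).
move=> _ [gamma cg <-]; rewrite image_risk lee_fin.
(* In these oriented coordinates b becomes [reoriented], and every coupling has the tails that
   [spectral_opt] asks for. *)
pose X (i : 'I_d) (x : borel_rV R d) : R := eps i * x ord0 i.
have mX i : measurable_fun setT (X i).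
  by apply: measurable_funM => //; exact: borel_rV_coord.
have mD : measurable (box I : set (borel_rV R d)) by exact: borel_rV_box.
have lawX i (A : set (measurableTypeR R)) : measurable A ->
    gamma (X i @^-1` A) = signed_law (eps i) (mu i) A.
  move=> mA; rewrite [RHS]lawE.
  have := @measurable_scale R (eps i) measurableT _ mA; rewrite setTI.
  exact: (cg i).
have PD : gamma (box I) = 1%E.
  pose A i : set (borel_rV R d) := (fun x : borel_rV R d => x ord0 i) @^-1` I i.
  have mI k : measurable (I k : set (measurableTypeR R)) by exact: is_interval_measurable.
  have mA k : measurable (A k).
    by rewrite -[X in measurable X]setTI; apply: borel_rV_coord => //; exact: mI.
  have PA k : gamma (A k) = 1%E by rewrite -(hmu k); exact: (cg k (I k)).
  exact: (prob_forall mA PA).2.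
apply: (@spectral_opt R d J f (reoriented_mono hS hinc hdec) (reoriented_id iI hb hS)
  oriented_quantile oriented_quantile_box oriented_quantile_nd comonotone_image
  comonotone_image_bm comonotone_imageE _ _ gamma X (box I) (b \_ (box I)) mX _
  mD PD _ (conj mb bbnd) _ mb a M) => //.
- move=> i t t01; have := real_quantile_tail (sB i) t01.
  by rewrite -lawX// preimage_itvoy.
- by move=> x Ix i; rewrite /Jbox /= /X mulrA orientK mul1r.
- move=> x Ix; rewrite patchE mem_set// /reoriented; congr (b _).
  by apply/rowP => i; rewrite mxE /flip /X mulrA orientK mul1r.
Qed.

End comonotone.

Lemma comonotone_stability {R : realType} d (I : 'I_d -> set R) (b : 'rV[R]_d -> R)
  (Sp : {set 'I_d}) (p K M B : R) (a : R -> R)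
  (mu nu : 'I_d -> probability (measurableTypeR R) R) :
  let e i := E unif (fun m : measurableTypeR R =>
    `|oriented_quantile Sp mu i m - oriented_quantile Sp nu i m| `^ p) in
  1 <= p -> 0 <= M ->
  pnorm_lipschitz_on (box I) p K b ->
  (forall i m, 0 < m < 1 -> Jbox I Sp i (oriented_quantile Sp mu i m)) ->
  (forall i m, 0 < m < 1 -> Jbox I Sp i (oriented_quantile Sp nu i m)) ->
  (forall i, @bm R _ (measurableTypeR R) (oriented_quantile Sp mu i)) ->
  (forall i, @bm R _ (measurableTypeR R) (oriented_quantile Sp nu i)) ->
  @bm R _ (measurableTypeR R) (comonotone_image I b Sp mu) ->
  @bm R _ (measurableTypeR R) (comonotone_image I b Sp nu) ->
  @bm R _ (measurableTypeR R) a -> (forall m, 0 <= a m <= M) ->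
  `|E unif (fun m => comonotone_image I b Sp mu m * a m) -
    E unif (fun m => comonotone_image I b Sp nu m * a m)|
    <= M * K * (\sum_(i < d) e i) `^ p^-1.
Proof.
move=> e p1 M0 bK Jmu Jnu bW bW' bh bh' ba aM.
have p0 : 0 < p by exact: lt_le_trans p1.
pose h := comonotone_image I b Sp mu; pose h' := comonotone_image I b Sp nu.
have bha : @bm R _ (measurableTypeR R) (fun m => h m * a m) by exact: bmM.
have bha' : @bm R _ (measurableTypeR R) (fun m => h' m * a m) by exact: bmM.
pose S (m : measurableTypeR R) :=
  \sum_(i < d) `|oriented_quantile Sp mu i m - oriented_quantile Sp nu i m| `^ p.
have bSi i : @bm R _ (measurableTypeR R)
    (fun m => `|oriented_quantile Sp mu i m - oriented_quantile Sp nu i m| `^ p).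
  by apply: bm_powR_norm => //; exact: bmB.
have bS : bm S by exact: bm_sum.
have S0 m : 0 <= S m by apply: sumr_ge0 => i _; exact: powR_ge0.
have ES : E unif S = \sum_(i < d) e i by exact: E_sum.
have [bN EN] := jensen_root unif p1 bS S0.
(* Sign changes preserve the p-norm, so [S m] is the p-th power of the distance between the two
   comonotone points. *)
have lip m : 0 < m < 1 -> `|h m - h' m| <= K * S m `^ p^-1.
  move=> m01.
  have Ix : box I (pt (flip Sp (oriented_quantile Sp mu ^~ m))).
    by apply: pt_box; apply: flip_box => i; exact: Jmu.
  have Iy : box I (pt (flip Sp (oriented_quantile Sp nu ^~ m))).
    by apply: pt_box; apply: flip_box => i; exact: Jnu.
  rewrite /h /h' /comonotone_image !patchE !mem_set//; apply: le_trans (bK _ _ Ix Iy) _.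
  rewrite /pnorm le_eqVlt; apply/orP; left; apply/eqP; congr (_ * _ `^ _).
  apply: eq_bigr => i _; congr (_ `^ _).
  by rewrite !mxE /flip -mulrBr normrM (sign_norm (orientK _ i)) mul1r.
have step : `|E unif (fun m => h m * a m) - E unif (fun m => h' m * a m)| <=
    M * K * E unif (fun m => S m `^ p^-1).
  have b1 : @bm R _ (measurableTypeR R) (fun m => h m * a m - h' m * a m) by exact: bmB.
  have b2 := bmZ (M * K) bN.
  have le m : 0 < m < 1 -> `|h m * a m - h' m * a m| <= M * K * S m `^ p^-1.
    move=> m01; have /andP[am0 amM] := aM m.
    rewrite -mulrBl normrM (ger0_norm am0) mulrC -mulrA.
    by apply: le_trans (ler_wpM2r (normr_ge0 _) amM) _; rewrite ler_wpM2l// lip.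
  rewrite -EB// -EZ// ler_norml -mulN1r -EZ//.
  apply/andP; split; apply: (E_le _ unif_open) => //; [exact: bmZ| |];
    by move=> m; rewrite /= in_itv/= => /le; rewrite ler_norml ?mulN1r => /andP[].
apply: le_trans step _; rewrite -ES.
have [K0|K0] := leP 0 K; first by apply: ler_wpM2l => //; exact: mulr_ge0.
(* A negative Lipschitz constant forces the box to be a point. *)
have N0 m : 0 < m < 1 -> S m `^ p^-1 = 0.
  move=> /lip /(le_trans (normr_ge0 _)); rewrite nmulr_rge0// => N0.
  by apply/eqP; rewrite eq_le N0 powR_ge0.
have EN0 : E unif (fun m => S m `^ p^-1) = 0.
  apply: etrans (E_cst unif 0); apply: (E_eq _ unif_open) => //; first exact: bm_cst.
have ES0 : E unif S = 0.
  apply: etrans (E_cst unif 0); apply: (E_eq _ unif_open) => //; first exact: bm_cst.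
  move=> m; rewrite /= in_itv/= => /N0 Nm.
  have Sm : S m = (S m `^ p^-1) `^ p by rewrite -powRrM mulVf ?gt_eqF// powRr1.
  by rewrite Sm Nm powR0// gt_eqF.
by rewrite EN0 ES0 powR0 ?lexx// invr_eq0 gt_eqF.
Qed.

Unset Implicit Arguments.
Set Strict Implicit.
Set Printing Implicit Defensive.

Theorem proposition32 (R : realType) (d : nat) (I : 'I_d -> set R)
  (b : 'rV[R]_d -> R) (Sp Sm : {set 'I_d}) (p K M : R) (alpha : R -> R)
  (hI : forall i, is_interval (I i) /\ bounded_set (I i))
  (hb : weakly_compatible (box I) b)
  (hS : associated_partition (box I) b Sp Sm)
  (hinc : forall i, i \in Sp -> increasing_in (box I) i b)
  (hdec : forall i, i \in Sm -> decreasing_in (box I) i b)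
  (hp : 1 <= p)
  (hK : pnorm_lipschitz_on (box I) p K b)
  (halpha0 : forall m, m \in `[0, 1] -> 0 <= alpha m)
  (halpha_nd : {in `[0, 1] &, {homo alpha : s t / s <= t}})
  (halphaM : forall m, m \in `[0, 1] -> alpha m <= M)
  (mu nu : 'I_d -> probability (measurableTypeR R) R)
  (hmu : forall i, mu i (I i) = 1%E)
  (hnu : forall i, nu i (I i) = 1%E) :
  exists Vmu Vnu : R,
    [/\ is_max [set spectral_risk alpha (image_law (box I) b gamma)
               | gamma in couplings mu] Vmu%:E,
        is_max [set spectral_risk alpha (image_law (box I) b gamma)
               | gamma in couplings nu] Vnu%:E &
        (`|Vmu - Vnu|%:E <=
          (M * K)%:E *
          (\sum_(i < d) Wasserstein p (mu i) (nu i) `^ p) `^ p^-1)%E].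
Proof.
have iI i : is_interval (I i) := (hI i).1.
have [B B0 IB] := bounded_box (fun i => (hI i).2).
have bbnd := pnorm_lipschitz_bounded hp IB hK.
(* [alpha] is controlled only on [0, 1]; composed with [clamp] it is monotone on all of R, hence
   measurable, and bounded everywhere. *)
pose clamp (m : R) : R := Num.max 0 (Num.min m 1).
have clamp_in m : clamp m \in `[0, 1].
  by rewrite in_itv/= /clamp le_max lexx/= ge_max ler01 ge_min lexx orbT.
pose a m := alpha (clamp m).
have aM m : 0 <= a m <= M by rewrite /a halpha0 ?halphaM.
have aE m : 0 < m < 1 -> a m = alpha m.
  by move=> /andP[/ltW m0 /ltW m1]; rewrite /a /clamp min_l// max_r.
have a_nd m m' : m <= m' -> a m <= a m'.
  move=> mm'; apply: halpha_nd => //; rewrite /clamp.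
  case: (leP m 1) => ?; case: (leP m' 1) => ?; case: (leP 0 m) => ?;
    case: (leP 0 m') => ?; case: (leP (0 : R) 1) => ?; lra.
have ba : @bm R _ (measurableTypeR R) a.
  split; first exact: nondecreasing_measurable.
  by exists M => m; have /andP[a0 a1] := aM m; rewrite ger0_norm.
have max rho hr := @comonotone_is_max R d I b Sp Sm B iI IB B0 hb hS hinc hdec bbnd rho hr
  alpha a M aE ba (fun m _ => aM m) (fun m m' _ mm' _ => a_nd m m' mm').
have muB (rho : probability (measurableTypeR R) R) i :
    rho (I i) = 1%E -> rho `[- B, B]%classic = 1%E.
  move=> h; apply/eqP; rewrite eq_le probability_le1//= -h le_measure ?inE//.
  exact: is_interval_measurable.
exists (E unif (fun m => comonotone_image I b Sp mu m * a m)),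
  (E unif (fun m => comonotone_image I b Sp nu m * a m)).
split; [exact: max | exact: max |].
have M0 : 0 <= M by have /andP[h1 h2] := aM 0; exact: le_trans h2.
have box_of (rho : 'I_d -> probability (measurableTypeR R) R) :
    (forall i, rho i (I i) = 1%E) -> forall i m, 0 < m < 1 ->
    Jbox I Sp i (oriented_quantile Sp rho i m).
  by move=> hr; exact: (oriented_quantile_box _ iI IB B0 hr).
have p0 : 0 < p by exact: lt_le_trans hp.
have WE i : (Wasserstein p (mu i) (nu i) `^ p)%E =
    (E unif (fun m : measurableTypeR R =>
       `|oriented_quantile Sp mu i m - oriented_quantile Sp nu i m| `^ p))%:E.
  rewrite (Wasserstein_quantile (orientK Sp i) hp B0 (muB _ _ (hmu i)) (muB _ _ (hnu i))).
  rewrite poweR_EFin -powRrM mulVf ?gt_eqF// powRr1//.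
  by apply: E_ge0 => m; exact: powR_ge0.
rewrite (eq_bigr _ (fun i _ => WE i)) sumEFin poweR_EFin -EFinM lee_fin.
apply: comonotone_stability => //.
- exact: box_of.
- exact: box_of.
- by move=> i; exact: (oriented_quantile_bm _ iI IB B0 hmu).
- by move=> i; exact: (oriented_quantile_bm _ iI IB B0 hnu).
- exact: (comonotone_image_bm _ iI IB B0 hb bbnd hmu).
- exact: (comonotone_image_bm _ iI IB B0 hb bbnd hnu).
Qed.
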